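(* Let $\mathfrak{g}$ be a $p$-step nilpotent Lie algebra over a field $k$, of type $(n_1,n_2,\ldots,n_p)$, dimension $m$, depth $d$ and with free $p$-step nilpotent extension $$0\to\mathfrak{n}\to\mathfrak{f}_{n_1,p}\xrightarrow{\pi}\mathfrak{g}\to0.$$ Define $c:=b_2(\mathfrak{f}_{n_1,d-1})-n_d$ and $C:=\binom{n_1}{2}+(m-n_1)(n_1-1)$. In general, $$c\le b_2(\mathfrak{g})\le C.$$ More specifically, if $\mathfrak{n}$ is generated by Lie monomials of degree $d$, then $$c\le b_2(\mathfrak{g})\le\min\{c+b_2(\mathfrak{f}_{n_1,p})-b_2(\mathfrak{f}_{n_1,p-1})+n_p,\;C\},$$ and if $\mathfrak{g}$ is of depth $p$ (i.e. $d=p$), then $$c+\max\{0,\;b_2(\mathfrak{f}_{n_1,p})-n_1b_2(\mathfrak{f}_{n_1,p-1})+n_1n_p\}\le b_2(\mathfrak{g})\le\min\{c+b_2(\mathfrak{f}_{n_1,p})-b_2(\mathfrak{f}_{n_1,p-1})+n_p,\;C\}.$$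
   Context: Lie algebras named are finite dimensional over an arbitrary field $k$, and $b_2(\mathfrak{h})=\dim_k\mathrm{H}^2(\mathfrak{h},k)$ with trivial coefficients. The lower central series is $\mathfrak{g}^1=\mathfrak{g}$, $\mathfrak{g}^{i+1}=[\mathfrak{g},\mathfrak{g}^i]$; $\mathfrak{g}$ is $p$-step nilpotent ($p\ge1$) if $\mathfrak{g}^p\ne0$, $\mathfrak{g}^{p+1}=0$. Its type is $(n_1,\dots,n_p)$ with $n_i=\dim_k\mathfrak{g}^i/\mathfrak{g}^{i+1}$. Let $\mathfrak{f}_n$ be the free Lie algebra over $k$ on $n$ generators, graded as $\mathfrak{f}_n=H_1(n)\oplus H_2(n)\oplus\cdots$ with $H_i(n)$ the span of Lie monomials of degree $i$ in the generators. $\mathfrak{f}_{n,r}=\mathfrak{f}_n/\mathfrak{f}_n^{r+1}=H_1(n)\oplus\dots\oplus H_r(n)$ is the free $r$-step nilpotent Lie algebra on $n$ generators. A free $p$-step nilpotent extension of $\mathfrak{g}$ is a short exact sequence of Lie algebras $0\to\mathfrak{n}\to\mathfrak{f}_{n_1,p}\xrightarrow{\pi}\mathfrak{g}\to0$ with $\mathfrak{n}\subset[\mathfrak{f}_{n_1,p},\mathfrak{f}_{n_1,p}]$ (here $n_1=\dim_k\mathfrak{g}/[\mathfrak{g},\mathfrak{g}]$). $\mathfrak{g}$ is of depth $d$ if $d$ is the largest integer such that $\mathfrak{n}\subseteq\mathfrak{f}_{n_1,p}^d$; this presupposes $\mathfrak{n}\neq0$, and then $d\in\{2,\dots,p\}$.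 It does not depend on the choice of free $p$-step nilpotent extension. ''$\mathfrak{n}$ is generated by Lie monomials of degree $d$'' means: $\mathfrak{n}$ is generated, as an ideal of $\mathfrak{f}_{n_1,p}$, by a subset of $H_d(n_1)$. *)

(* Defs.v *)
From HB Require Import structures.
From mathcomp Require Import all_boot all_order all_algebra.
From mathcomp Require Import boolp classical_sets.

Set Implicit Arguments.
Unset Strict Implicit.
Unset Printing Implicit Defensive.

Import GRing.Theory.
Local Open Scope ring_scope.
Local Open Scope quotient_scope.

(* The axiom [lieb x x = 0], rather than antisymmetry, is the correct one in
   characteristic 2. *)
HB.mixin Record isLie (K : fieldType) V of GRing.Lmodule K V := {
  lieb : V -> V -> V;
  lieb_linearl : forall y, linear (lieb^~ y);
  lieb_linearr : forall x, linear (lieb x);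
  liebxx : forall x, lieb x x = 0;
  lieb_jacobi : forall x y z,
    lieb x (lieb y z) + lieb y (lieb z x) + lieb z (lieb x y) = 0 }.

#[short(type="lieAlgType")]
HB.structure Definition LieAlgebra (K : fieldType) :=
  {V of isLie K V & GRing.Lmodule K V}.

#[short(type="lieVectType")]
HB.structure Definition LieVect (K : fieldType) :=
  {V of isLie K V & Vector K V}.

Section Span.
Variables (K : fieldType) (V : lmodType K).
Implicit Types A S : set V.

Definition subspace S : Prop :=
  S 0 /\ forall (a : K) x y, S x -> S y -> S (a *: x + y).

Definition lspan A : set V :=
  [set x | forall S, subspace S -> (A `<=` S)%classic -> S x].

Lemma lspan_subspace A : subspace (lspan A).
Proof.
split=> [S [] //|a x y Ax Ay S hS AS].
by apply: hS.2; [apply: Ax | apply: Ay].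
Qed.

Lemma lspan_sub A : (A `<=` lspan A)%classic.
Proof. by move=> x Ax S _; apply. Qed.

Lemma lspan_min A S : subspace S -> (A `<=` S)%classic -> (lspan A `<=` S)%classic.
Proof. by move=> hS AS x; apply. Qed.

Lemma subspaceD S x y : subspace S -> S x -> S y -> S (x + y).
Proof. by move=> hS Sx Sy; rewrite -[x]scale1r; apply: hS.2. Qed.

Lemma subspaceZ S a x : subspace S -> S x -> S (a *: x).
Proof. by move=> hS Sx; rewrite -[_ *: _]addr0; apply: hS.2 => //; apply: hS.1. Qed.

Lemma subspaceN S x : subspace S -> S x -> S (- x).
Proof. by move=> hS Sx; rewrite -scaleN1r; apply: subspaceZ. Qed.

Lemma subspaceB S x y : subspace S -> S x -> S y -> S (x - y).
Proof. by move=> hS Sx Sy; apply: subspaceD => //; apply: subspaceN. Qed.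

End Span.

Section VSpan.
Variables (K : fieldType) (V : vectType K).

Lemma vspan_subproof (A : set V) :
  exists U : {vspace V}, forall x, (x \in U) <-> lspan A x.
Proof.
pose P k := `[< exists2 U : {vspace V}, \dim U = k & forall x, x \in U -> lspan A x >].
have [s0 sL] := lspan_subspace A.
have P0 : exists k, P k.
  exists 0; apply/asboolP; exists 0%VS; first exact: dimv0.
  by move=> x; rewrite memv0 => /eqP->.
have Pmax k : P k -> (k <= dim V)%N.
  by move=> /asboolP[U <- _]; rewrite -dimvf; apply: dimvS; apply: subvf.
case: (ex_maxnP P0 Pmax) => k /asboolP[U dU UA] kmax.
exists U => x; split; first exact: UA.
move=> Ax; have /kmax : P (\dim (U + <[x]>)).
  apply/asboolP; exists (U + <[x]>)%VS => // _ /memv_addP[u Uu [_ /vlineP[a ->] ->]].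
  by rewrite addrC; apply: sL => //; apply: UA.
rewrite -dU => le_dim.
have /eqP-> : U == (U + <[x]>)%VS by rewrite eqEdim addvSl.
by apply: (subvP (addvSr _ _)); apply: memv_line.
Qed.

Definition vspan (A : set V) : {vspace V} := projT1 (cid (vspan_subproof A)).

Lemma vspanP (A : set V) x : x \in vspan A <-> lspan A x.
Proof. exact: (projT2 (cid (vspan_subproof A)) x). Qed.

Lemma vspan_subspaceP (A : set V) x : subspace A -> x \in vspan A <-> A x.
Proof.
move=> hA; rewrite vspanP; split; last exact: lspan_sub.
exact: (lspan_min hA).
Qed.

End VSpan.

Section LieTheory.
Variables (K : fieldType) (L : lieAlgType K).
Implicit Types (x y z : L) (S : set L).

Lemma lieb0r x : lieb x 0 = 0.
Proof. by have := lieb_linearr x (-1) 0 0; rewrite !scaleN1r !addNr. Qed.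
Lemma lieb0l x : lieb 0 x = 0.
Proof. by have := lieb_linearl x (-1) 0 0; rewrite !scaleN1r !addNr. Qed.
Lemma liebDr x y z : lieb x (y + z) = lieb x y + lieb x z.
Proof. by have := lieb_linearr x 1 y z; rewrite !scale1r. Qed.
Lemma liebDl x y z : lieb (y + z) x = lieb y x + lieb z x.
Proof. by have := lieb_linearl x 1 y z; rewrite !scale1r. Qed.
Lemma liebZr x a y : lieb x (a *: y) = a *: lieb x y.
Proof. by have := lieb_linearr x a y 0; rewrite !addr0 lieb0r addr0. Qed.
Lemma liebZl x a y : lieb (a *: y) x = a *: lieb y x.
Proof. by have := lieb_linearl x a y 0; rewrite !addr0 lieb0l addr0. Qed.
Lemma liebNr x y : lieb x (- y) = - lieb x y.
Proof. by rewrite -scaleN1r liebZr scaleN1r. Qed.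
Lemma lieb_anti x y : lieb x y = - lieb y x.
Proof.
apply/eqP; rewrite -addr_eq0; apply/eqP.
by have := liebxx (x + y); rewrite liebDl !liebDr !liebxx add0r addr0.
Qed.

Lemma lieb_leibniz x y z :
  lieb (lieb x y) z = lieb x (lieb y z) - lieb y (lieb x z).
Proof.
rewrite [LHS]lieb_anti; apply/eqP; rewrite eq_sym -addr_eq0; apply/eqP.
by rewrite [lieb x z]lieb_anti liebNr opprK; apply: lieb_jacobi.
Qed.

Definition lie_ideal S : Prop :=
  subspace S /\ forall x y, S y -> S (lieb x y).

Definition ideal_gen S : set L :=
  [set x | forall I, lie_ideal I -> (S `<=` I)%classic -> I x].

(* [lcs 1] is the whole algebra; the value at [0] is a convention. *)
Fixpoint lcs (i : nat) : set L :=
  match i with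
  | 0 | 1 => setT
  | i'.+1 => lspan [set z | exists x y, lcs i' y /\ z = lieb x y]
  end.

Lemma lcsSS i :
  lcs i.+2 = lspan [set z | exists x y, lcs i.+1 y /\ z = lieb x y].
Proof. by []. Qed.

Lemma lcs_subspace i : subspace (lcs i).
Proof. by case: i => [|[|i]] //; apply: lspan_subspace. Qed.

Lemma lcs_lieb i x y : lcs i y -> lcs i.+1 (lieb x y).
Proof. by case: i => [|i] // hy; apply: lspan_sub; exists x, y. Qed.

Lemma lcs_decrS i : (lcs i.+1 `<=` lcs i)%classic.
Proof.
elim: i => [|[|i] IH] // x.
rewrite lcsSS; apply: lspan_min; first exact: lcs_subspace.
by move=> _ [y [z [hz ->]]]; apply/lcs_lieb/IH.
Qed.

Lemma lcs_decr i j : (i <= j)%N -> (lcs j `<=` lcs i)%classic.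
Proof.
move=> /subnK <-; elim: (j - i)%N => [|k IH] x //.
by move/lcs_decrS/IH.
Qed.

Lemma lcs_ideal i : lie_ideal (lcs i).
Proof.
by split=> [|x y /(@lcs_lieb _ x)/lcs_decrS //]; exact: lcs_subspace.
Qed.

Lemma lcs_liebD i j x y :
  lcs i.+1 x -> lcs j.+1 y -> lcs (i + j).+2%N (lieb x y).
Proof.
elim: i j x y => [|i IH] j x y; first by move=> _; apply: lcs_lieb.
move=> hx hy; move: x hx; apply: lspan_min.
  have sp := lcs_subspace (i.+1 + j).+2.
  split=> [|a u v hu hv]; rewrite ?lieb0l; first exact: sp.1.
  by rewrite liebDl liebZl; apply: sp.2.
move=> _ [a [b [hb ->]]]; rewrite lieb_leibniz.
apply: (subspaceB (lcs_subspace (i.+1 + j).+2)).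
  by apply: (@lcs_lieb (i + j).+2); apply: IH.
by rewrite addSnnS; apply: IH => //; apply: (@lcs_lieb j.+1).
Qed.

Section Monomials.
Variables (n : nat) (x : 'I_n -> L).

(* [lie_monomial d u]: [u] is a Lie monomial of degree [d] in the [x i]. *)
Inductive lie_monomial : nat -> L -> Prop :=
| LieMonGen i : lie_monomial 1%N (x i)
| LieMonBracket d e u v :
    lie_monomial d u -> lie_monomial e v -> lie_monomial (d + e)%N (lieb u v).

Lemma lie_monomial_lcs d u : lie_monomial d u -> (0 < d)%N /\ lcs d u.
Proof.
elim=> // {d u} [[|d] [|e]] u v _ [// _ hu] _ [// _ hv]; split=> //.
by rewrite addnS addSn; apply: lcs_liebD.
Qed.

(* For the generators of the free nilpotent Lie algebra of class [r] this is, when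
   [d <= r], the homogeneous component of degree [d]. *)
Definition homog (d : nat) : set L := lspan (lie_monomial d).

End Monomials.
End LieTheory.

Arguments lcs {K} L i.

Definition lie_morphism (K : fieldType) (L M : lieAlgType K) (f : L -> M) : Prop :=
  linear f /\ forall x y, f (lieb x y) = lieb (f x) (f y).

(* The free Lie algebra on [n] generators: formal expressions in the generators
   and the operations of a Lie algebra, modulo the least congruence which forces
   the axioms of a Lie algebra over [K]. *)
Section FreeLie.
Variables (K : fieldType) (n : nat).

Inductive lexpr :=
| LGen of 'I_n
| LZero
| LOpp of lexpr
| LAdd of lexpr & lexpr
| LScale of K & lexpr
| LBr of lexpr & lexpr.

HB.instance Definition _ := gen_eqMixin lexpr.
HB.instance Definition _ := gen_choiceMixin lexpr.

Inductive lcong : lexpr -> lexpr -> Prop :=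
| lc_refl u : lcong u u
| lc_sym u v : lcong u v -> lcong v u
| lc_trans u v w : lcong u v -> lcong v w -> lcong u w
| lc_opp u u' : lcong u u' -> lcong (LOpp u) (LOpp u')
| lc_add u u' v v' : lcong u u' -> lcong v v' -> lcong (LAdd u v) (LAdd u' v')
| lc_scale a u u' : lcong u u' -> lcong (LScale a u) (LScale a u')
| lc_br u u' v v' : lcong u u' -> lcong v v' -> lcong (LBr u v) (LBr u' v')
| lc_addA u v w : lcong (LAdd u (LAdd v w)) (LAdd (LAdd u v) w)
| lc_addC u v : lcong (LAdd u v) (LAdd v u)
| lc_add0 u : lcong (LAdd LZero u) u
| lc_addN u : lcong (LAdd (LOpp u) u) LZero
| lc_scaleA a b u : lcong (LScale a (LScale b u)) (LScale (a * b) u)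
| lc_scale1 u : lcong (LScale 1 u) u
| lc_scaleDr a u v : lcong (LScale a (LAdd u v)) (LAdd (LScale a u) (LScale a v))
| lc_scaleDl a b u : lcong (LScale (a + b) u) (LAdd (LScale a u) (LScale b u))
| lc_brl a u v w :
    lcong (LBr (LAdd (LScale a u) v) w) (LAdd (LScale a (LBr u w)) (LBr v w))
| lc_brr a u v w :
    lcong (LBr w (LAdd (LScale a u) v)) (LAdd (LScale a (LBr w u)) (LBr w v))
| lc_brxx u : lcong (LBr u u) LZero
| lc_jacobi u v w :
    lcong (LAdd (LAdd (LBr u (LBr v w)) (LBr v (LBr w u))) (LBr w (LBr u v))) LZero.

Definition lcongb (u v : lexpr) : bool := `[< lcong u v >].

Lemma lcongb_refl : reflexive lcongb.
Proof. by move=> u; apply/asboolP/lc_refl. Qed.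
Lemma lcongb_sym : symmetric lcongb.
Proof. by move=> u v; apply/asboolP/asboolP => /lc_sym. Qed.
Lemma lcongb_trans : transitive lcongb.
Proof. by move=> v u w /asboolP uv /asboolP vw; apply/asboolP/(lc_trans uv). Qed.

Canonical lcong_equiv := EquivRel lcongb lcongb_refl lcongb_sym lcongb_trans.

Definition freeLie := {eq_quot lcong_equiv}.
HB.instance Definition _ := Choice.on freeLie.

Let cls (u : lexpr) : freeLie := \pi_{eq_quot lcong_equiv} u.

Let clsP u v : cls u = cls v <-> lcong u v.
Proof.
split=> [/eqmodP /asboolP //|uv]; apply/eqmodP; exact/asboolP.
Qed.

Let clsW (P : freeLie -> Prop) : (forall u, P (cls u)) -> forall x, P x.
Proof. by move=> h x; rewrite -[x]reprK; apply: h. Qed.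

Let rcls u : lcong (repr (cls u)) u.
Proof. by apply/clsP; rewrite /cls reprK. Qed.

Definition fl_gen i : freeLie := cls (LGen i).
Definition fl_zero : freeLie := cls LZero.
Definition fl_opp (x : freeLie) : freeLie := cls (LOpp (repr x)).
Definition fl_add (x y : freeLie) : freeLie := cls (LAdd (repr x) (repr y)).
Definition fl_scale a (x : freeLie) : freeLie := cls (LScale a (repr x)).
Definition fl_br (x y : freeLie) : freeLie := cls (LBr (repr x) (repr y)).

Let oppE u : fl_opp (cls u) = cls (LOpp u).
Proof. by apply/clsP/lc_opp/rcls. Qed.
Let addE u v : fl_add (cls u) (cls v) = cls (LAdd u v).
Proof. by apply/clsP/lc_add; apply: rcls. Qed.
Let scaleE a u : fl_scale a (cls u) = cls (LScale a u).
Proof. by apply/clsP/lc_scale/rcls. Qed.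
Let brE u v : fl_br (cls u) (cls v) = cls (LBr u v).
Proof. by apply/clsP/lc_br; apply: rcls. Qed.

Lemma fl_addA : associative fl_add.
Proof.
elim/clsW=> u; elim/clsW=> v; elim/clsW=> w.
by rewrite !addE; apply/clsP/lc_addA.
Qed.
Lemma fl_addC : commutative fl_add.
Proof. by elim/clsW=> u; elim/clsW=> v; rewrite !addE; apply/clsP/lc_addC. Qed.
Lemma fl_add0 : left_id fl_zero fl_add.
Proof. by elim/clsW=> u; rewrite addE; apply/clsP/lc_add0. Qed.
Lemma fl_addN : left_inverse fl_zero fl_opp fl_add.
Proof. by elim/clsW=> u; rewrite oppE addE; apply/clsP/lc_addN. Qed.

HB.instance Definition _ :=
  GRing.isZmodule.Build freeLie fl_addA fl_addC fl_add0 fl_addN.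

Lemma fl_scaleA a b v : fl_scale a (fl_scale b v) = fl_scale (a * b) v.
Proof. by elim/clsW: v => u; rewrite !scaleE; apply/clsP/lc_scaleA. Qed.
Lemma fl_scale1 : left_id 1 fl_scale.
Proof. by elim/clsW=> u; rewrite !scaleE; apply/clsP/lc_scale1. Qed.
Lemma fl_scaleDr : right_distributive fl_scale +%R.
Proof.
move=> a; elim/clsW=> u; elim/clsW=> v.
by rewrite -[LHS]/(fl_scale a (fl_add _ _)) -[RHS]/(fl_add _ _) !(addE, scaleE);
  apply/clsP/lc_scaleDr.
Qed.
Lemma fl_scaleDl v : {morph fl_scale^~ v : a b / a + b}.
Proof.
elim/clsW: v => u a b.
by rewrite /= -[RHS]/(fl_add _ _) !(addE, scaleE); apply/clsP/lc_scaleDl.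
Qed.

HB.instance Definition _ :=
  GRing.Zmodule_isLmodule.Build K freeLie fl_scaleA fl_scale1 fl_scaleDr fl_scaleDl.

Lemma fl_brl w : linear (fl_br^~ w).
Proof.
move=> a; elim/clsW: w => w; elim/clsW=> u; elim/clsW=> v.
rewrite -[_ *: _ + cls v]/(fl_add (fl_scale _ _) _).
rewrite -[RHS]/(fl_add (fl_scale _ _) _) !(addE, scaleE, brE).
by apply/clsP/lc_brl.
Qed.
Lemma fl_brr w : linear (fl_br w).
Proof.
move=> a; elim/clsW: w => w; elim/clsW=> u; elim/clsW=> v.
rewrite -[_ *: _ + cls v]/(fl_add (fl_scale _ _) _).
rewrite -[RHS]/(fl_add (fl_scale _ _) _) !(addE, scaleE, brE).
by apply/clsP/lc_brr.
Qed.
Lemma fl_brxx x : fl_br x x = 0.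
Proof. by elim/clsW: x => u; rewrite brE; apply/clsP/lc_brxx. Qed.
Lemma fl_jacobi x y z :
  fl_br x (fl_br y z) + fl_br y (fl_br z x) + fl_br z (fl_br x y) = 0.
Proof.
elim/clsW: x => u; elim/clsW: y => v; elim/clsW: z => w.
rewrite -[LHS]/(fl_add (fl_add _ _) _) !(addE, brE).
by apply/clsP/lc_jacobi.
Qed.

HB.instance Definition _ :=
  isLie.Build K freeLie fl_brl fl_brr fl_brxx fl_jacobi.

Lemma fl_ind (S : set freeLie) :
    subspace S -> (forall x y, S x -> S y -> S (lieb x y)) ->
  (forall i, S (fl_gen i)) -> forall x, S x.
Proof.
move=> hS hb hg; elim/clsW; elim=> [i|||||].
- exact: hg.
- exact: hS.1.
- by move=> u hu; rewrite -oppE; apply: (subspaceN hS hu).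
- by move=> u hu v hv; rewrite -addE; apply: (subspaceD hS hu hv).
- by move=> a u hu; rewrite -scaleE; apply: (subspaceZ a hS hu).
- by move=> u hu v hv; rewrite -brE; apply: hb.
Qed.

Section Universal.
Variables (L : lieAlgType K) (y : 'I_n -> L).

Fixpoint leval (u : lexpr) : L :=
  match u with
  | LGen i => y i
  | LZero => 0
  | LOpp u => - leval u
  | LAdd u v => leval u + leval v
  | LScale a u => a *: leval u
  | LBr u v => lieb (leval u) (leval v)
  end.

Lemma leval_cong u v : lcong u v -> leval u = leval v.
Proof.
elim=> {u v} //=; try congruence.
- by move=> *; rewrite addrA.
- by move=> *; rewrite addrC.
- by move=> *; rewrite add0r.
- by move=> *; rewrite addNr.
- by move=> *; rewrite scalerA.
- by move=> *; rewrite scale1r.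
- by move=> *; rewrite scalerDr.
- by move=> *; rewrite scalerDl.
- by move=> *; rewrite liebDl liebZl.
- by move=> *; rewrite liebDr liebZr.
- by move=> *; rewrite liebxx.
- by move=> *; rewrite lieb_jacobi.
Qed.

Definition fl_lift (x : freeLie) : L := leval (repr x).

Lemma fl_lift_cls u : fl_lift (cls u) = leval u.
Proof. exact/leval_cong/rcls. Qed.

Lemma fl_universal :
  exists f : freeLie -> L, [/\ lie_morphism f, forall i, f (fl_gen i) = y i &
    forall g, lie_morphism g -> (forall i, g (fl_gen i) = y i) -> g =1 f].
Proof.
have liftM : lie_morphism fl_lift.
  split=> [a|]; elim/clsW=> u; elim/clsW=> v.
    rewrite -[_ *: _ + cls v]/(fl_add (fl_scale _ _) _) scaleE addE.
    by rewrite !fl_lift_cls.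
  by rewrite -[lieb _ _]/(fl_br _ _) brE !fl_lift_cls.
exists fl_lift; split=> // [i|g gM gy].
  exact: fl_lift_cls.
have lin0 (h : freeLie -> L) : lie_morphism h -> h 0 = 0.
  by move=> [hl _]; have := hl (-1) 0 0; rewrite !scaleN1r !addNr.
apply: fl_ind => [|x z /= gx gz|i /=].
- split=> [|a x z /= gx gz]; first by rewrite /= !lin0.
  by rewrite gM.1 liftM.1 gx gz.
- by rewrite gM.2 liftM.2 gx gz.
- by rewrite gy fl_lift_cls.
Qed.

End Universal.
End FreeLie.

(* The quotient of [L] by its ideal [lcs L r.+1]. *)
Section NilQuotient.
Variables (K : fieldType) (L : lieAlgType K) (r : nat).

Let I := lcs L r.+1.
Let I_sub : subspace I := lcs_subspace L r.+1.

Definition nqcong (x y : L) : bool := `[< lcs L r.+1 (x - y) >].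

Lemma nqcong_refl : reflexive nqcong.
Proof. by move=> x; apply/asboolP; rewrite subrr; apply: I_sub.1. Qed.
Lemma nqcong_sym : symmetric nqcong.
Proof.
by move=> x y; apply/asboolP/asboolP => /(subspaceN I_sub); rewrite opprB.
Qed.
Lemma nqcong_trans : transitive nqcong.
Proof.
move=> y x z /asboolP xy /asboolP yz; apply/asboolP.
by have := subspaceD I_sub xy yz; rewrite addrA subrK.
Qed.

Canonical nq_equiv := EquivRel nqcong nqcong_refl nqcong_sym nqcong_trans.

Definition nilquot := {eq_quot nq_equiv}.
HB.instance Definition _ := Choice.on nilquot.

Definition nq_pi (x : L) : nilquot := \pi_{eq_quot nq_equiv} x.

Lemma nq_piP x y : nq_pi x = nq_pi y <-> lcs L r.+1 (x - y).
Proof.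
split=> [/eqmodP /asboolP //|xy]; apply/eqmodP; exact/asboolP.
Qed.

Lemma nq_piW (P : nilquot -> Prop) : (forall x, P (nq_pi x)) -> forall x, P x.
Proof. by move=> h x; rewrite -[x]reprK; apply: h. Qed.

Let rpi x : I (repr (nq_pi x) - x).
Proof. by apply/nq_piP; rewrite /nq_pi reprK. Qed.

Definition nq_zero : nilquot := nq_pi 0.
Definition nq_opp (x : nilquot) : nilquot := nq_pi (- repr x).
Definition nq_add (x y : nilquot) : nilquot := nq_pi (repr x + repr y).
Definition nq_scale a (x : nilquot) : nilquot := nq_pi (a *: repr x).
Definition nq_br (x y : nilquot) : nilquot := nq_pi (lieb (repr x) (repr y)).

Let oppE x : nq_opp (nq_pi x) = nq_pi (- x).
Proof. by apply/nq_piP; rewrite -opprD; apply: (subspaceN I_sub (rpi x)). Qed.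
Let addE x y : nq_add (nq_pi x) (nq_pi y) = nq_pi (x + y).
Proof.
by apply/nq_piP; rewrite opprD addrACA; apply: (subspaceD I_sub (rpi x) (rpi y)).
Qed.
Let scaleE a x : nq_scale a (nq_pi x) = nq_pi (a *: x).
Proof. by apply/nq_piP; rewrite -scalerBr; apply: (subspaceZ a I_sub (rpi x)). Qed.
Let brE x y : nq_br (nq_pi x) (nq_pi y) = nq_pi (lieb x y).
Proof.
apply/nq_piP; have [_ Ib] := lcs_ideal L r.+1.
set x' := repr _; set y' := repr _.
have -> : lieb x' y' - lieb x y = lieb x' (y' - y) - lieb y (x' - x).
  rewrite !liebDr !liebNr [lieb y x']lieb_anti [lieb y x]lieb_anti opprK.
  by rewrite opprD opprK addrA subrK.
by apply: (subspaceB I_sub); apply: Ib; apply: rpi.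
Qed.

Lemma nq_addA : associative nq_add.
Proof.
elim/nq_piW=> u; elim/nq_piW=> v; elim/nq_piW=> w.
by rewrite !addE addrA.
Qed.
Lemma nq_addC : commutative nq_add.
Proof. by elim/nq_piW=> u; elim/nq_piW=> v; rewrite !addE addrC. Qed.
Lemma nq_add0 : left_id nq_zero nq_add.
Proof. by elim/nq_piW=> u; rewrite addE add0r. Qed.
Lemma nq_addN : left_inverse nq_zero nq_opp nq_add.
Proof. by elim/nq_piW=> u; rewrite oppE addE addNr. Qed.

HB.instance Definition _ :=
  GRing.isZmodule.Build nilquot nq_addA nq_addC nq_add0 nq_addN.

Lemma nq_piD x y : nq_pi (x + y) = nq_pi x + nq_pi y.
Proof. by rewrite -addE. Qed.

Lemma nq_scaleA a b v : nq_scale a (nq_scale b v) = nq_scale (a * b) v.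
Proof. by elim/nq_piW: v => u; rewrite !scaleE scalerA. Qed.
Lemma nq_scale1 : left_id 1 nq_scale.
Proof. by elim/nq_piW=> u; rewrite !scaleE scale1r. Qed.
Lemma nq_scaleDr : right_distributive nq_scale +%R.
Proof.
move=> a; elim/nq_piW=> u; elim/nq_piW=> v.
by rewrite -nq_piD !scaleE -nq_piD scalerDr.
Qed.
Lemma nq_scaleDl v : {morph nq_scale^~ v : a b / a + b}.
Proof. by elim/nq_piW: v => u a b; rewrite /= !scaleE -nq_piD scalerDl. Qed.

HB.instance Definition _ :=
  GRing.Zmodule_isLmodule.Build K nilquot nq_scaleA nq_scale1 nq_scaleDr nq_scaleDl.

Lemma nq_piZ a x : nq_pi (a *: x) = a *: nq_pi x.
Proof. by rewrite -scaleE. Qed.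

Lemma nq_brl w : linear (nq_br^~ w).
Proof.
move=> a; elim/nq_piW: w => w; elim/nq_piW=> u; elim/nq_piW=> v.
by rewrite -nq_piZ -nq_piD !brE liebDl liebZl nq_piD nq_piZ.
Qed.
Lemma nq_brr w : linear (nq_br w).
Proof.
move=> a; elim/nq_piW: w => w; elim/nq_piW=> u; elim/nq_piW=> v.
by rewrite -nq_piZ -nq_piD !brE liebDr liebZr nq_piD nq_piZ.
Qed.
Lemma nq_brxx x : nq_br x x = 0.
Proof. by elim/nq_piW: x => u; rewrite brE liebxx. Qed.
Lemma nq_jacobi x y z :
  nq_br x (nq_br y z) + nq_br y (nq_br z x) + nq_br z (nq_br x y) = 0.
Proof.
elim/nq_piW: x => u; elim/nq_piW: y => v; elim/nq_piW: z => w.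
by rewrite !brE -!nq_piD lieb_jacobi.
Qed.

HB.instance Definition _ :=
  isLie.Build K nilquot nq_brl nq_brr nq_brxx nq_jacobi.

Lemma nq_pi_morph : lie_morphism nq_pi.
Proof.
split=> [a x y|x y]; first by rewrite nq_piD nq_piZ.
by rewrite -brE.
Qed.

Lemma nq_pi0 : nq_pi 0 = 0.
Proof. by []. Qed.

Lemma nq_pi_eq0 x : nq_pi x = 0 <-> lcs L r.+1 x.
Proof. by rewrite -nq_pi0 nq_piP subr0. Qed.

End NilQuotient.

Section FinDim.
Variables (K : fieldType) (M : lmodType K) (s : seq M).
Hypothesis s_span : forall x, lspan [set` s] x.

Lemma findim_subproof : {N & Vector.axiom N M}.
Proof.
pose N := size s.
pose phi (u : 'rV[K]_N) : M := \sum_(i < N) u 0 i *: s`_i.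
have phiP a u v : phi (a *: u + v) = a *: phi u + phi v.
  rewrite /phi scaler_sumr -big_split; apply: eq_bigr => i _ /=.
  by rewrite !mxE scalerDl scalerA.
have phi0 : phi 0 = 0.
  by rewrite /phi big1 // => i _; rewrite mxE scale0r.
have phiS m : exists u, phi u = m.
  move: m (s_span m); apply: lspan_min.
    split; first by exists 0.
    by move=> a _ _ [u <-] [v <-]; exists (a *: u + v).
  move=> x /= xs; have ix : (index x s < N)%N by rewrite index_mem.
  exists (delta_mx 0 (Ordinal ix)); rewrite /phi (bigD1 (Ordinal ix)) //=.
  rewrite mxE !eqxx scale1r nth_index // big1 ?addr0 // => j /negPf jx.
  by rewrite mxE jx andbF scale0r.
pose P k := `[< exists2 U : {vspace 'rV[K]_N}, \dim U = k &
  forall m, exists2 u, u \in U & phi u = m >].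
have exP : exists k, P k.
  exists (\dim {:'rV[K]_N}); apply/asboolP; exists fullv => // m.
  by have [u <-] := phiS m; exists u => //; apply: memvf.
have /cid2[U US Uinj] : exists2 U : {vspace 'rV[K]_N},
    (forall m, exists2 u, u \in U & phi u = m) &
    (forall u, u \in U -> phi u = 0 -> u = 0).
  case: (ex_minnP exP) => k /asboolP[U dU US] kmin; exists U => // u uU u0.
  apply/eqP/negPn/negP => un0.
  have /kmin : P (\dim (U :\: <[u]>)%VS).
    apply/asboolP; exists (U :\: <[u]>)%VS => // m.
    have [w wU wm] := US m.
    move: wU; rewrite -{1}(addv_diff_cap U <[u]>) => /memv_addP[w1 w1U [w2 + wE]].
    rewrite memv_cap => /andP[_ /vlineP[a w2E]]; exists w1 => //.
    by rewrite -wm wE w2E addrC phiP u0 scaler0 add0r.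
  rewrite -dU -{1}(dimv_cap_compl U <[u]>) (capv_idPr _).
    by rewrite dim_vline un0 add1n ltnn.
  by rewrite -memvE.
pose f m := s2val (cid2 (US m)).
have fU m : f m \in U by exact: s2valP (cid2 (US m)).
have fK m : phi (f m) = m by exact: s2valP' (cid2 (US m)).
have Kf u : u \in U -> f (phi u) = u.
  move=> uU; apply/eqP; rewrite -subr_eq0; apply/eqP/Uinj; first by rewrite rpredB.
  by rewrite addrC -scaleN1r phiP fK scaleN1r addNr.
exists (\dim U), (fun m => \row_i coord (vbasis U) i (f m)) => [a x y|].
  apply/rowP => i; rewrite !mxE -linearP; congr (coord _ _ _).
  by rewrite -[in LHS](fK x) -[in LHS](fK y) -phiP Kf // memvD // memvZ.
exists (fun r : 'rV_(\dim U) => phi (\sum_i r 0 i *: (vbasis U)`_i)) => [m|r].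
  by rewrite -[RHS]fK [in RHS](coord_vbasis (fU m)); congr phi;
    apply: eq_bigr => i _; rewrite mxE.
apply/rowP => i; rewrite mxE Kf; last first.
  by apply: rpred_sum => j _; apply/memvZ/vbasis_mem/mem_nth; rewrite size_tuple.
by rewrite coord_sum_free // (basis_free (vbasisP U)).
Qed.

End FinDim.

Section FreeNilpotent.
Variables (K : fieldType) (n r : nat).

Definition freeNil : Type := nilquot (freeLie K n) r.
HB.instance Definition _ := LieAlgebra.on freeNil.

Definition fn_gen (i : 'I_n) : freeNil := nq_pi r (fl_gen K i).

Let proj : freeLie K n -> freeNil := @nq_pi K (freeLie K n) r.
Let projD x y : proj (x + y) = proj x + proj y := nq_piD r x y.
Let projZ a x : proj (a *: x) = a *: proj x := nq_piZ r a x.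
Let projB x y : proj (lieb x y) = lieb (proj x) (proj y) := (nq_pi_morph _ r).2 x y.

Lemma freeNil_lcs_eq0 (x : freeNil) : lcs freeNil r.+1 x -> x = 0.
Proof.
suff H i (y : freeNil) : lcs freeNil i y -> exists2 z, lcs (freeLie K n) i z & proj z = y.
  by case/H => z /nq_pi_eq0 + <-.
have HT (y' : freeNil) : exists2 z, setT z & proj z = y'.
  by elim/nq_piW: y' => z; exists z.
elim: i y => [|[|i] IH] // y; rewrite lcsSS.
pose S : set freeNil := (fun y => exists2 z, lcs (freeLie K n) i.+2 z & proj z = y).
apply: (@lspan_min _ _ _ S).
  have sp := lcs_subspace (freeLie K n) i.+2.
  split; first by exists 0; [exact: sp.1|].
  move=> a _ _ [u hu <-] [v hv <-]; exists (a *: u + v).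
    exact: sp.2.
  by rewrite projD projZ.
move=> _ [u [v [/IH[v' hv' <-] ->]]]; have [u' _ <-] := HT u.
by exists (lieb u' v'); [apply: (@lcs_lieb _ _ i.+1)|rewrite projB].
Qed.

Let mon : set freeNil := [set u | exists d, lie_monomial fn_gen d u].

Lemma freeNil_mon_span (x : freeNil) : lspan mon x.
Proof.
have sp := lspan_subspace mon.
elim/nq_piW: x; apply: fl_ind => [|x y|i]; last first.
- by apply: lspan_sub; exists 1%N; apply: LieMonGen.
- rewrite /= -!/(proj _) projB => hx hy.
  move: (proj x) hx.
  apply: (@lspan_min _ _ _ (fun u => lspan mon (lieb u (proj y)))).
    split=> [|a u v hu hv] /=; first by rewrite lieb0l; apply: sp.1.
    by rewrite liebDl liebZl; apply: sp.2.
  move=> u [d hu] /=; move: (proj y) hy.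
  apply: (@lspan_min _ _ _ (fun v => lspan mon (lieb u v))).
    split=> [|a v w hv hw] /=; first by rewrite lieb0r; apply: sp.1.
    by rewrite liebDr liebZr; apply: sp.2.
  by move=> v [e hv]; apply: lspan_sub; exists (d + e)%N; apply: LieMonBracket.
- split=> [|a x y hx hy] /=; first exact: sp.1.
  by rewrite -/(proj _) projD projZ; apply: sp.2.
Qed.

Fixpoint mon_seq (k : nat) : seq freeNil :=
  if k is k'.+1 then
    [seq fn_gen i | i <- enum 'I_n] ++
    [seq (lieb u v : freeNil) | u <- mon_seq k', v <- mon_seq k']
  else [::].

Lemma mem_mon_seq k d u : lie_monomial fn_gen d u -> (d <= k)%N -> u \in mon_seq k.
Proof.
move=> hu; elim: hu k => {d u} [i|d e u v hu IHu hv IHv] [|k] //=.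
- by move=> _; rewrite mem_cat map_f // mem_enum.
- by have [+ _] := lie_monomial_lcs hu; case: (d).
have [d0 _] := lie_monomial_lcs hu; have [e0 _] := lie_monomial_lcs hv.
move=> dek; rewrite mem_cat; apply/orP; right; apply: allpairs_f.
  by apply: IHu; rewrite -ltnS; apply: leq_trans dek; rewrite -addn1 leq_add2l.
by apply: IHv; rewrite -ltnS; apply: leq_trans dek; rewrite -add1n leq_add2r.
Qed.

Lemma freeNil_span (x : freeNil) : lspan [set` mon_seq r] x.
Proof.
have sp := lspan_subspace [set` mon_seq r].
move: x (freeNil_mon_span x); apply: lspan_min => // u [d hu].
have [dr|rd] := leqP d r; first by apply: lspan_sub; apply: (mem_mon_seq hu).
rewrite (@freeNil_lcs_eq0 u); first exact: sp.1.
exact: (lcs_decr rd (lie_monomial_lcs hu).2).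
Qed.

HB.instance Definition _ :=
  Lmodule_hasFinDim.Build K freeNil (projT2 (findim_subproof freeNil_span)).

End FreeNilpotent.

Section Cohomology.
Variables (K : fieldType) (h : lieVectType K).

Local Notation cochain := 'Hom(h, 'Hom(h, K^o)).

(* Alternating forms killed by the Chevalley-Eilenberg differential. *)
Definition cocycle2 : set cochain :=
  [set w : cochain | (forall x, w x x = 0) /\
    forall x y z, w (lieb x y) z + w (lieb y z) x + w (lieb z x) y = 0].

Definition coboundary2 : set cochain :=
  [set w : cochain | exists a : 'Hom(h, K^o), forall x y, w x y = - a (lieb x y)].

Lemma cocycle2_subspace : subspace cocycle2.
Proof.
split=> [|a v w [v0 vJ] [w0 wJ]]; split=> [x|x y z].
- by rewrite !zero_lfunE.
- by rewrite !zero_lfunE !addr0.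
- by rewrite !(add_lfunE, scale_lfunE) v0 w0 scaler0 addr0.
- rewrite !(add_lfunE, scale_lfunE) [X in X + _]addrACA -scalerDr addrACA -scalerDr.
  by rewrite vJ wJ scaler0 addr0.
Qed.

Lemma coboundary2_subspace : subspace coboundary2.
Proof.
split=> [|a v w [v' vE] [w' wE]].
  by exists 0 => x y; rewrite !zero_lfunE oppr0.
exists (a *: v' + w') => x y; rewrite !(add_lfunE, scale_lfunE).
by rewrite vE wE scalerN opprD.
Qed.

Lemma coboundary2_cocycle2 : (coboundary2 `<=` cocycle2)%classic.
Proof.
move=> w [a wE]; split=> [x|x y z]; first by rewrite wE liebxx linear0 oppr0.
rewrite !wE -!opprD -!linearD /=.
suff -> : lieb (lieb x y) z + lieb (lieb y z) x + lieb (lieb z x) y = 0.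
  by rewrite linear0 oppr0.
rewrite (lieb_anti (lieb x y)) (lieb_anti (lieb y z)) (lieb_anti (lieb z x)).
by rewrite -!opprD lieb_jacobi oppr0.
Qed.

End Cohomology.

(* [\dim (A / B)] for linear subspaces [B `<=` A]; the truncated subtraction is
   then exact. *)
Definition quodim (K : fieldType) (V : vectType K) (A B : set V) : nat :=
  (\dim (vspan A) - \dim (vspan B))%N.

Definition b2 (K : fieldType) (h : lieVectType K) : nat :=
  quodim (@cocycle2 K h) (@coboundary2 K h).

Section Extensions.
Variables (K : fieldType) (g : lieVectType K).

Definition step_nilpotent (p : nat) : Prop :=
  [/\ (0 < p)%N, exists2 x, lcs g p x & x != 0 &
      forall x, lcs g p.+1 x -> x = 0].

(* Only the values of [n] at 1, ..., p are constrained. *)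
Definition has_type (p : nat) (n : nat -> nat) : Prop :=
  forall i, (1 <= i <= p)%N -> n i = quodim (lcs g i) (lcs g i.+1).

Variables (n1 p : nat) (f : freeNil K n1 p -> g).

Definition ext_ker : set (freeNil K n1 p) := [set x | f x = 0].

Definition free_nilpotent_ext : Prop :=
  [/\ lie_morphism f, forall y, exists x, f x = y &
      (ext_ker `<=` lcs (freeNil K n1 p) 2)%classic].

Definition has_depth (d : nat) : Prop :=
  [/\ exists2 x, ext_ker x & x != 0,
      (ext_ker `<=` lcs (freeNil K n1 p) d)%classic &
      forall e, (ext_ker `<=` lcs (freeNil K n1 p) e)%classic -> (e <= d)%N].

Definition generated_in_degree (d : nat) : Prop :=
  exists2 S : set (freeNil K n1 p), (S `<=` homog (@fn_gen K n1 p) d)%classic &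
    ext_ker = ideal_gen S.

End Extensions.

(* Main.v *)
Require Import Defs.
From HB Require Import structures.
From mathcomp Require Import all_boot all_order all_algebra.
From mathcomp Require Import boolp classical_sets functions.
From mathcomp Require Import ring zify.

(** Write [L] for the free Lie algebra on [n] generators, [F] for its quotient
    [freeNil K n p.+1], one step longer than the one in the extension, and [R] for the
    kernel of the composite surjection from [F] to [g]. Everything is read off from
    the dimensions of ideals of [F], starting from Hopf's formula

      b2 g = dim R - dim [F, R]                                   [hopf_formula].

    It holds because a linear form on [F] killing [[F, R]] induces a 2-cocycle of [g],
    and because every 2-cocycle arises in this way: [F] lifts to the central extension
    of [g] which the cocycle defines. Applied to the free nilpotent algebras it says
    that [b2 (freeNil K n i)] is the dimension of the degree [i + 1] part of [L]
    [b2_freeNil], and it turns the constant [c] into [dim R - dim (R :&: lcs F d.+1)].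

    The lower bound [c] is then the inclusion of [[F, R]] in [lcs F d.+1]. The bound
    [C], and the lower bound for depth [p], come from one estimate: for ideals
    [B <= A] the brackets with [A] are spanned, modulo [[F, B]], by those of the [n]
    generators with a complement of [B] in [A], so that
    [dim [F, A] <= dim [F, B] + n * (dim A - dim B)] [sdim_brs].

    The remaining upper bound needs many brackets instead of few. If the kernel is
    generated in degree [d], then [R :&: lcs F d.+1] is contained in
    [[F, R] + lcs F p.+1] [generated_low], and what has to be shown is that the part of
    [[F, R]] in degree [p + 1] is at least as large as the part of [R] in degree [p].
    It is, because bracketing with a single generator is injective in degrees above
    one [ad_gen_inj].

    This injectivity is the statement that the centraliser of a generator of [L] is a
    line; it is proved in the tensor algebra, where an element commuting with a letter
    is a polynomial in that letter. The embedding of [L] in the tensor algebra is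
    obtained, in any characteristic, from a faithful module of [freeNil K n r]
    [nilpotent_faithful]: a Lie polynomial without coefficients acts as zero in every
    module, in particular in this one. The faithful module is built by coinduction
    along a chain of ideals, with an explicit recursive formula for the action. *)

Set Implicit Arguments.
Unset Strict Implicit.
Unset Printing Implicit Defensive.

Import Order.TTheory GRing.Theory Num.Theory.
Local Open Scope ring_scope.

(** * Dimensions of spans, ideals and morphisms *)

Section SetDim.
Variables (K : fieldType) (V : vectType K).
Implicit Types A B : set V.

Definition sdim A : nat := \dim (vspan A).

Lemma sdim_le A B : (A `<=` B)%classic -> (sdim A <= sdim B)%N.
Proof.
move=> AB; apply/dimvS/subvP => x /vspanP Ax; apply/vspanP.
by move=> S sS BS; apply: Ax => // y /AB/BS.
Qed.

Lemma vspan_sub A (U : {vspace V}) :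
  (forall x, A x -> x \in U) -> (vspan A <= U)%VS.
Proof.
move=> AU; apply/subvP => x /vspanP Ax; apply: (Ax [set y | y \in U]%classic) => //.
by split=> [|a y z yU zU]; rewrite /= ?mem0v // memvD // memvZ.
Qed.

Lemma sdimT : sdim [set: V] = \dim {:V}.
Proof.
congr (\dim _); apply/vspaceP => x; rewrite memvf; apply/vspanP.
by apply: lspan_sub.
Qed.

Lemma sdim_eq0 A : (forall x, A x -> x = 0) -> sdim A = 0%N.
Proof.
move=> A0; apply/eqP; rewrite dimv_eq0 -subv0; apply: vspan_sub => x /A0->.
exact: mem0v.
Qed.

Lemma subspaceI A B : subspace A -> subspace B -> subspace (A `&` B)%classic.
Proof.
move=> sA sB; split; first by split; [exact: sA.1|exact: sB.1].
by move=> a x y [Ax Bx] [Ay By]; split; [apply: sA.2|apply: sB.2].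
Qed.

Lemma sdim_sumle A B C : subspace A -> subspace B ->
  (forall x, C x -> exists y z, [/\ A y, B z & x = y + z]) ->
  (sdim C + sdim (A `&` B)%classic <= sdim A + sdim B)%N.
Proof.
move=> sA sB CAB; rewrite /sdim -(dimv_sum_cap (vspan A)); apply: leq_add; apply: dimvS.
  apply: vspan_sub => x /CAB[y [z [Ay Bz ->]]].
  by apply: memv_add; [apply/(vspan_subspaceP _ sA)|apply/(vspan_subspaceP _ sB)].
apply: vspan_sub => x [Ax Bx]; rewrite memv_cap.
by apply/andP; split; [apply/(vspan_subspaceP _ sA)|apply/(vspan_subspaceP _ sB)].
Qed.

End SetDim.

Lemma sdim_rank (K : fieldType) (V W : vectType K) (f : V -> W)
    (A : set V) : linear f -> subspace A ->
  sdim A = (sdim (f @` A)%classic + sdim [set x | A x /\ f x = 0%R])%N.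
Proof.
move=> lf sA.
pose lfM := GRing.isLinear.Build K V W *:%R f lf.
pose F : {linear V -> W} := HB.pack f lfM.
pose h : 'Hom(V, W) := linfun F.
have hE x : h x = f x by rewrite lfunE.
rewrite /sdim -(limg_ker_dim h (vspan A)) addnC; congr (_ + _)%N.
  congr (\dim _); apply/vspaceP => y; apply/idP/idP.
    case/memv_imgP=> x xA ->; apply/vspanP; apply: lspan_sub; rewrite hE; apply: imageP.
    exact/(vspan_subspaceP _ sA).
  move: y; apply/subvP; apply: vspan_sub => _ [x Ax <-]; rewrite -hE.
  by apply/memv_img/(vspan_subspaceP _ sA).
congr (\dim _); apply/vspaceP => y; rewrite memv_cap memv_ker hE.
apply/idP/idP.
  case/andP=> yA /eqP y0; apply/vspanP; apply: lspan_sub; split=> //.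
  exact/(vspan_subspaceP _ sA).
rewrite -hE -memv_ker -memv_cap; move: y; apply/subvP; apply: vspan_sub => x [Ax x0].
by rewrite memv_cap memv_ker hE x0 eqxx andbT; apply/(vspan_subspaceP _ sA).
Qed.

Section Brackets.
Variables (K : fieldType) (L : lieAlgType K).

Lemma liebNl (x y : L) : lieb (- x) y = - lieb x y.
Proof. by rewrite -scaleN1r liebZl scaleN1r. Qed.

(** Written so that [lcs L i.+2] is [brs (lcs L i.+1)] by computation. *)
Definition brs (S : set L) : set L :=
  lspan [set z | exists x y, S y /\ z = lieb x y].

Lemma brs_subspace S : subspace (brs S).
Proof. exact: lspan_subspace. Qed.

Lemma brs_lieb S x y : S y -> brs S (lieb x y).
Proof. by move=> Sy; apply: lspan_sub; exists x, y. Qed.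

Lemma brs_ideal_sub S : lie_ideal S -> (brs S `<=` S)%classic.
Proof.
by move=> [sS bS]; apply: lspan_min => // _ [x [y [Sy ->]]]; apply: bS.
Qed.

End Brackets.

Section Morphisms.
Variables (K : fieldType) (L M : lieAlgType K) (f : L -> M).
Hypothesis fM : lie_morphism f.

Lemma lmorphD x y : f (x + y) = f x + f y.
Proof. by have := fM.1 1 x y; rewrite !scale1r. Qed.
Lemma lmorph0 : f 0 = 0.
Proof. by have := fM.1 (-1) 0 0; rewrite !scaleN1r !addNr. Qed.
Lemma lmorphZ a x : f (a *: x) = a *: f x.
Proof. by have := fM.1 a x 0; rewrite lmorph0 !addr0. Qed.
Lemma lmorphB x y : f (x - y) = f x - f y.
Proof. by rewrite -scaleN1r lmorphD lmorphZ scaleN1r. Qed.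

Lemma ker_ideal : lie_ideal [set x | f x = 0].
Proof.
split=> [|x y /= y0]; last by rewrite fM.2 y0 lieb0r.
split=> [|a x y /= x0 y0]; first exact: lmorph0.
by rewrite lmorphD lmorphZ x0 y0 scaler0 addr0.
Qed.

Lemma preim_subspace (S : set M) : subspace S -> subspace [set x | S (f x)].
Proof.
move=> sS; split=> [|a x y /= Sx Sy]; rewrite /= ?lmorph0; first exact: sS.1.
by rewrite lmorphD lmorphZ; apply: sS.2.
Qed.

Lemma lcs_morph i x : lcs L i x -> lcs M i (f x).
Proof.
elim: i x => [|[|i] IH] // x; move: x.
apply: (@lspan_min _ _ _ [set x | lcs M i.+2 (f x)]).
  exact/preim_subspace/lcs_subspace.
by move=> _ [x [y [hy ->]]] /=; rewrite fM.2; apply: (@lcs_lieb _ _ i.+1); apply: IH.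
Qed.

Lemma lcs_morph_onto : (forall y, exists x, f x = y) ->
  forall i y, lcs M i y -> exists2 x, lcs L i x & f x = y.
Proof.
move=> fS; have T y : exists2 x, [set: L]%classic x & f x = y.
  by have [x] := fS y; exists x.
elim=> [|[|i] IH] y //; move: y.
apply: (@lspan_min _ _ _ (fun y => exists2 x, lcs L i.+2 x & f x = y)).
  have sp := lcs_subspace L i.+2; split.
    by exists 0; [exact: sp.1|exact: lmorph0].
  move=> a _ _ [x hx <-] [y hy <-]; exists (a *: x + y); first exact: sp.2.
  by rewrite lmorphD lmorphZ.
move=> _ [u [v [/IH[y hy <-] ->]]]; have [x <-] := fS u.
by exists (lieb x y); [apply: (@lcs_lieb _ _ i.+1)|rewrite fM.2].
Qed.

End Morphisms.

(** * Morphisms from free nilpotent Lie algebras, central extensions *)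

Section FreeNilpotentMorphisms.
Variables (K : fieldType) (n : nat).

Lemma fn_ind r (S : set (freeNil K n r)) : subspace S ->
  (forall x y, S x -> S y -> S (lieb x y)) -> (forall i, S (@fn_gen K n r i)) ->
  forall x, S x.
Proof.
move=> sS bS gS; elim/nq_piW.
have qM := nq_pi_morph (freeLie K n) r.
apply: (@fl_ind _ _ [set x | S (nq_pi r x)]) => [|x y /= Sx Sy|i]; last exact: gS.
  exact: (preim_subspace qM sS).
by rewrite qM.2; apply: bS.
Qed.

(** The universal property: in an algebra of class at most [r] the images of the
    generators are arbitrary. *)
Lemma fn_lift (M : lieAlgType K) r (y : 'I_n -> M) :
  (forall x, lcs M r.+1 x -> x = 0) ->
  exists f : freeNil K n r -> M, lie_morphism f /\ forall i, f (@fn_gen K n r i) = y i.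
Proof.
move=> M0; have [h [hM hg _]] := fl_universal y.
have hP u v : nq_pi r u = nq_pi r v -> h u = h v.
  move=> /nq_piP/(lcs_morph hM)/M0; rewrite (lmorphB hM) => /eqP.
  by rewrite subr_eq0 => /eqP.
have hr u : h (repr (nq_pi r u)) = h u by apply: hP; rewrite /nq_pi reprK.
have qM := nq_pi_morph (freeLie K n) r.
exists (fun x => h (repr x)); split; last by move=> i; rewrite hr.
split=> [a x z|x z]; elim/nq_piW: x => x; elim/nq_piW: z => z.
  by rewrite -qM.1 !hr hM.1.
by rewrite -qM.2 !hr hM.2.
Qed.

Lemma fn_morph_eq (M : lieAlgType K) r (f h : freeNil K n r -> M) :
  lie_morphism f -> lie_morphism h ->
  (forall i, f (@fn_gen K n r i) = h (@fn_gen K n r i)) -> forall x, f x = h x.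
Proof.
move=> fM hM fh; apply: fn_ind => // [|x y /= fx fy]; last by rewrite fM.2 hM.2 fx fy.
by split=> [|a x y /= fx fy]; rewrite /= ?lmorph0 // fM.1 hM.1 fx fy.
Qed.

Lemma fn_proj r s : (s <= r)%N -> exists q : freeNil K n r -> freeNil K n s,
  [/\ lie_morphism q, forall i, q (@fn_gen K n r i) = @fn_gen K n s i,
      forall y, exists x, q x = y & forall x, q x = 0 <-> lcs (freeNil K n r) s.+1 x].
Proof.
move=> sr; have [x /(lcs_decr (_ : s < r.+1)%N) h|q [qM qg]] :=
  @fn_lift (freeNil K n s) r (@fn_gen K n s).
  exact/freeNil_lcs_eq0/h.
have qE x : q (nq_pi r x) = nq_pi s x.
  have rM := nq_pi_morph (freeLie K n) r; have sM := nq_pi_morph (freeLie K n) s.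
  move: x; apply: fl_ind => [|x y /= hx hy|i]; last exact: qg.
    split=> [|a x y /= hx hy]; first by rewrite /= !nq_pi0 (lmorph0 qM).
    by rewrite rM.1 sM.1 qM.1 hx hy.
  by rewrite rM.2 sM.2 qM.2 hx hy.
exists q; split=> // [|x].
  by elim/nq_piW=> y; exists (nq_pi r y); rewrite qE.
split; last by move/(lcs_morph qM)/freeNil_lcs_eq0.
elim/nq_piW: x => x; rewrite qE => /nq_pi_eq0.
exact: lcs_morph (nq_pi_morph _ r) _ _.
Qed.

End FreeNilpotentMorphisms.

Section CentralExtension.
Variables (K : fieldType) (g : lieVectType K) (w : 'Hom(g, 'Hom(g, K^o))).
Hypothesis wZ : cocycle2 w.

(** The cocycle condition is an argument so that the type determines the bracket. *)
Definition cext of cocycle2 w : Type := (g * K^o)%type.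
HB.instance Definition _ (h : cocycle2 w) := GRing.Lmodule.on (cext h).
Local Notation E := (cext wZ).

Definition cext_br (x y : E) : E := (lieb x.1 y.1, w x.1 y.1).

Lemma cext_brl y : linear (cext_br^~ y).
Proof.
move=> a u v; congr pair; rewrite /= ?liebDl ?liebZl //.
by rewrite linearP /= !(add_lfunE, scale_lfunE).
Qed.
Lemma cext_brr y : linear (cext_br y).
Proof.
move=> a u v; congr pair; rewrite /= ?liebDr ?liebZr //.
by rewrite linearP.
Qed.
Lemma cext_brxx x : cext_br x x = 0.
Proof. by congr pair; rewrite /= ?liebxx ?wZ.1. Qed.
Lemma cext_jacobi x y z :
  cext_br x (cext_br y z) + cext_br y (cext_br z x) + cext_br z (cext_br x y) = 0.
Proof.
congr pair => /=; first exact: lieb_jacobi.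
have anti u v : w u v = - w v u.
  apply/eqP; rewrite -addr_eq0; apply/eqP; have := wZ.1 (u + v).
  by rewrite !linearD /= !add_lfunE /= !wZ.1 add0r addr0 addrC.
rewrite (anti x.1) (anti y.1) (anti z.1) -!opprD.
by rewrite addrC addrA wZ.2 oppr0.
Qed.

HB.instance Definition _ :=
  isLie.Build K E cext_brl cext_brr cext_brxx cext_jacobi.

(** The kernel of the projection onto [g] is central, so that the nilpotency class
    grows by at most one. *)
Lemma cext_lcs r : (forall x, lcs g r.+1 x -> x = 0) ->
  forall x : E, lcs E r.+2 x -> x = 0.
Proof.
move=> g0; have pM : lie_morphism (fst : E -> g) by [].
move=> x; rewrite lcsSS; move: x; apply: (@lspan_min _ _ _ [set x : E | x = 0]).
  by split=> // a x y /= -> ->; rewrite scaler0 addr0.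
move=> _ [x [y [hy ->]]] /=; have y0 : y.1 = 0 by apply: g0 (lcs_morph pM hy).
by rewrite /lieb /= /cext_br y0 lieb0r linear0.
Qed.

End CentralExtension.

(** * Annihilators *)

Section Annihilator.
Variables (K : fieldType) (V : vectType K).
Implicit Types A : set V.

Definition ann A : set 'Hom(V, K^o) := [set a | forall x, A x -> a x = 0]%classic.

Lemma ann_subspace A : subspace (ann A).
Proof.
split=> [x _|a b c hb hc x Ax]; first by rewrite zero_lfunE.
by rewrite add_lfunE scale_lfunE hb // hc // scaler0 addr0.
Qed.

Lemma ann_lspan A (a : 'Hom(V, K^o)) :
  (forall x, A x -> a x = 0) -> ann (lspan A) a.
Proof.
move=> aA; apply: (@lspan_min _ _ _ [set x | a x = 0]) => //.
by split=> [|b x y /= x0 y0]; rewrite /= ?linear0 // linearP /= x0 y0 scaler0 addr0.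
Qed.

Lemma sdim_ann A : subspace A -> (sdim (ann A) + sdim A)%N = \dim {:V}.
Proof.
move=> sA; set U := vspan A.
pose ev (a : 'Hom(V, K^o)) : 'rV[K]_(\dim U) := \row_i a (vbasis U)`_i.
have evL : linear ev.
  by move=> b a c; apply/rowP => i; rewrite !mxE add_lfunE scale_lfunE.
have sT : subspace [set: 'Hom(V, K^o)] by [].
have := sdim_rank evL sT; rewrite sdimT dimvf /= [dim _]/dim /= muln1 -dimvf => ->.
rewrite addnC; congr (_ + _)%N.
  rewrite /sdim -/U -[LHS]mul1n -[(1 * _)%N](dimvf 'rV[K]_(\dim U)) -sdimT.
  congr sdim; apply/seteqP; split=> // r _.
  exists (\sum_i r 0 i *: linfun (coord (vbasis U) i : V -> K^o)) => //.
  apply/rowP => j; rewrite mxE sum_lfunE (bigD1 j) //= scale_lfunE lfunE /=.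
  rewrite coord_free ?(basis_free (vbasisP U)) // eqxx [_ *: _]mulr1 big1 ?addr0 // => i ij.
  rewrite scale_lfunE lfunE /= coord_free ?(basis_free (vbasisP U)) //.
  by rewrite eq_sym (negPf ij) scaler0.
congr sdim; apply/seteqP; split=> a.
  move=> aA; split=> //; apply/rowP => i; rewrite !mxE.
  apply: aA; apply/(vspan_subspaceP _ sA)/vbasis_mem/mem_nth.
  by rewrite size_tuple.
move=> [_ a0] x /(vspan_subspaceP _ sA) xU; rewrite (coord_vbasis xU) linear_sum.
rewrite big1 // => i _; rewrite linearZ /=.
by have /rowP/(_ i) := a0; rewrite !mxE => ->; rewrite scaler0.
Qed.

End Annihilator.

(** * Hopf's formula *)

Section Hopf.
Variables (K : fieldType) (g : lieVectType K) (n r : nat) (f : freeNil K n r -> g).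
Hypothesis fM : lie_morphism f.
Hypothesis fS : forall y, exists x, f x = y.
Local Notation F := (freeNil K n r).
Local Notation R := (ext_ker f).

(** A linear section of [f] is fixed to turn linear forms on [F] into bilinear
    forms on [g]; on the forms killing the brackets with [R] nothing depends on
    the section. *)
Lemma ext_section : exists s : 'Hom(g, F), forall y, f (s y) = y.
Proof.
pose lfM := GRing.isLinear.Build K F g *:%R f fM.1.
pose G : {linear F -> g} := HB.pack f lfM.
exists (linfun G)^-1%VF => y; have /limg_lfunVK : y \in limg (linfun G).
  by have [x <-] := fS y; apply/memv_imgP; exists x; rewrite ?memvf // lfunE.
by rewrite lfunE.
Qed.

Lemma brform_exists (s : 'Hom(g, F)) :
  exists2 T : 'Hom(F, K^o) -> 'Hom(g, 'Hom(g, K^o)), linear T &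
    forall a x y, T a x y = a (lieb (s x) (s y)).
Proof.
have adP (x : F) : exists h : 'End(F), forall y, h y = lieb x y.
  pose lM := GRing.isLinear.Build K F F *:%R (lieb x) (lieb_linearr x).
  pose G : {linear F -> F} := HB.pack (lieb x) lM.
  by exists (linfun G) => y; rewrite lfunE.
have TP (a : 'Hom(F, K^o)) : exists w : 'Hom(g, 'Hom(g, K^o)),
    forall x y, w x y = a (lieb (s x) (s y)).
  pose G x : 'Hom(g, K^o) := (a \o (projT1 (cid (adP (s x))) \o s))%VF.
  have GE x y : G x y = a (lieb (s x) (s y)).
    by rewrite /G !comp_lfunE; case: cid => h /= ->.
  have lG : linear G.
    move=> b x y; apply/lfunP => z.
    by rewrite add_lfunE scale_lfunE !GE !linearP liebDl liebZl linearP.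
  pose lM := GRing.isLinear.Build K g 'Hom(g, K^o) *:%R G lG.
  pose H : {linear g -> 'Hom(g, K^o)} := HB.pack G lM.
  by exists (linfun H) => x y; rewrite lfunE /= GE.
exists (fun a => projT1 (cid (TP a))) => [b a c|a x y]; last by case: cid.
apply/lfunP => x; apply/lfunP => y.
case: cid => u /= uE; case: cid => v /= vE; case: cid => w /= wE.
by rewrite !(add_lfunE, scale_lfunE) uE vE wE !(add_lfunE, scale_lfunE).
Qed.

(** Hopf's formula. A form on [F] killing [[F, R]] defines a 2-cocycle
    [(f u, f v) |-> a [u, v]] of [g], and every 2-cocycle arises in this way because
    [f] lifts to the central extension that the cocycle defines. The cocycle is
    determined by the restriction of the form to [[F, F]], and the coboundaries come
    from the forms killing [R]; so [b2 g] is the difference in dimension of the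
    annihilators of [[F, R]] and [R]. *)
Theorem hopf_formula : (0 < r)%N -> (R `<=` lcs F 2)%classic ->
  (forall x, lcs g r x -> x = 0) -> (b2 g + sdim (brs R) = sdim R)%N.
Proof.
move=> r0 R2 g0; have [s sK] := ext_section.
have [T TL TE] := brform_exists s.
have Rid : lie_ideal R := ker_ideal fM.
have sR u : R (s (f u) - u) by rewrite /ext_ker /= (lmorphB fM) sK subrr.
have TfE a u v : ann (brs R) a -> T a (f u) (f v) = a (lieb u v).
  move=> aR; rewrite TE; apply/eqP; rewrite -subr_eq0 -linearB /=; apply/eqP.
  have -> : lieb (s (f u)) (s (f v)) - lieb u v =
      lieb (s (f u)) (s (f v) - v) - lieb v (s (f u) - u).
    rewrite !liebDr !liebNr [lieb v (s _)]lieb_anti [lieb v u]lieb_anti !opprK.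
    by rewrite opprD opprK addrA subrK.
  by rewrite linearB /= !aR ?subrr //; apply: brs_lieb.
have annR : (ann R `<=` ann (brs R))%classic.
  by move=> a aR x /(brs_ideal_sub Rid)/aR.
have annF : (ann (lcs F 2) `<=` ann R)%classic by move=> a aF x /R2/aF.
have kerT A : (ann (lcs F 2) `<=` A)%classic -> (A `<=` ann (brs R))%classic ->
    [set a | A a /\ T a = 0%R]%classic = ann (lcs F 2).
  move=> FA AR; apply/seteqP; split=> [a [/AR aR Ta]|a aF].
    rewrite lcsSS; apply: ann_lspan => _ [x [y [_ ->]]].
    by rewrite -TfE // Ta !zero_lfunE.
  split; first exact: FA.
  apply/lfunP => x; apply/lfunP => y; rewrite TE !zero_lfunE; apply: aF.
  exact: (@lcs_lieb _ _ 1).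
(* The second component of a lift of [f] to the central extension is a linear form
   on [F] whose values on brackets are the given cocycle. *)
have imR1 : (T @` ann (brs R))%classic = @cocycle2 K g.
  apply/seteqP; split=> [_ [a aR <-]|w wZ].
    split=> [x|x y z]; first by rewrite TE liebxx linear0.
    have [x' <-] := fS x; have [y' <-] := fS y; have [z' <-] := fS z.
    rewrite -!fM.2 !TfE // -!linearD /= (lieb_anti (lieb x' y')).
    rewrite (lieb_anti (lieb y' z')) (lieb_anti (lieb z' x')) -!opprD.
    by rewrite lieb_jacobi oppr0 linear0.
  pose E := cext wZ.
  have [rr r0'] : exists rr, r = rr.+1 by exists r.-1; rewrite prednK.
  have [x|h [hM hg]] := @fn_lift K n E r (fun i => (f (@fn_gen K n r i), 0)).
    by rewrite r0' => /cext_lcs; apply=> y; rewrite -r0'; apply: g0.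
  have pM : lie_morphism (fst : E -> g) by [].
  have hf u : (h u).1 = f u.
    apply: (@fn_morph_eq _ _ _ _ (fun u => (h u).1)) => // [|i]; last by rewrite hg.
    by split=> [a x y|x y]; rewrite ?hM.1 ?hM.2.
  pose a u : K^o := (h u).2.
  have aL : linear a by move=> b x y; rewrite /a hM.1.
  pose lM := GRing.isLinear.Build K F K^o *:%R a aL.
  pose G : {linear F -> K^o} := HB.pack a lM.
  have aE u v : linfun G (lieb u v) = w (f u) (f v).
    by rewrite lfunE /= /a hM.2 -!hf.
  exists (linfun G).
    apply: ann_lspan => _ [x [y [Ry ->]]].
    by rewrite aE Ry linear0.
  by apply/lfunP => x; apply/lfunP => y; rewrite TE aE !sK.
have imR2 : (T @` ann R)%classic = @coboundary2 K g.
  apply/seteqP; split=> [_ [a aR <-]|w [b wE]].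
    exists (- (a \o s))%VF => x y; rewrite TE opp_lfunE opprK comp_lfunE.
    apply/eqP; rewrite -subr_eq0 -linearB; apply/eqP; apply: aR.
    by rewrite /ext_ker /= (lmorphB fM) fM.2 !sK subrr.
  pose lM := GRing.isLinear.Build K F g *:%R f fM.1.
  pose G : {linear F -> g} := HB.pack f lM.
  have aE u : (- (b \o linfun G))%VF u = - b (f u).
    by rewrite opp_lfunE comp_lfunE lfunE.
  exists (- (b \o linfun G))%VF; first by move=> x Rx; rewrite aE Rx linear0 oppr0.
  by apply/lfunP => x; apply/lfunP => y; rewrite TE aE fM.2 !sK wE.
have := sdim_rank TL (ann_subspace (brs R)).
have := sdim_rank TL (ann_subspace R).
rewrite imR1 imR2 !kerT // /b2 /quodim -!/(sdim _); last first.
  exact: subset_trans annF annR.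
have := etrans (sdim_ann (brs_subspace R)) (esym (sdim_ann Rid.1)).
have := sdim_le (brs_ideal_sub Rid).
move: (sdim (ann (brs R))) (sdim (ann R)) (sdim (ann (lcs F 2))) => a1 a2 a0.
move: (sdim (brs R)) (sdim R) (sdim (@cocycle2 K g)) (sdim (@coboundary2 K g)).
lia.
Qed.

End Hopf.

(** * Faithful modules of nilpotent Lie algebras *)

Section Representations.
Variables (K : fieldType) (L : lieAlgType K).

(** The action is a function on all of [L] but represents only [S], so that the
    representations of a growing chain of subalgebras share one type. *)
Record lie_rep (S : set L) (M : lmodType K) (rho : L -> M -> M) : Prop := LieRep {
  rep_linr : forall x, linear (rho x);
  rep_linl : forall a x y m, S x -> S y ->
    rho (a *: x + y) m = a *: rho x m + rho y m;
  rep_br : forall x y m, S x -> S y ->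
    rho (lieb x y) m = rho x (rho y m) - rho y (rho x m) }.

Definition has_faithful_rep (S : set L) : Prop :=
  exists (M : lmodType K) (rho : L -> M -> M), [/\ lie_rep S rho,
    exists m : M, m != 0 & forall x, S x -> (forall m, rho x m = 0) -> x = 0].

End Representations.

(** Coinduction from a subalgebra [S] to [S + K e], where [e] normalises [S]. With [e]
    acting on [nat -> M] as the shift, the relation [e y = y e + [e, y]] dictates how
    [y] acts. No division is needed, hence no hypothesis on the characteristic. *)
Section Coinduction.
Variables (K : fieldType) (L : lieAlgType K) (S : set L) (e : L).
Hypotheses (sS : subspace S) (bS : forall x y, S x -> S y -> S (lieb x y)).
Hypotheses (eS : forall y, S y -> S (lieb e y)) (enS : ~ S e).
Variables (M : lmodType K) (rho : L -> M -> M).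
Hypothesis rhoR : lie_rep S rho.

Definition shift (f : nat -> M) : nat -> M := fun j => f j.+1.

Fixpoint coact (y : L) (f : nat -> M) (j : nat) {struct j} : M :=
  if j is k.+1 then coact (lieb e y) f k + coact y (shift f) k else rho y (f 0%N).

Lemma coact_linr y : linear (coact y).
Proof.
move=> a f h; apply/funext => j.
rewrite -[RHS]/(a *: coact y f j + coact y h j).
elim: j y f h => [|j IH] y f h /=; first by rewrite (rep_linr rhoR).
rewrite (_ : shift (a *: f + h) = a *: shift f + shift h) //.
by rewrite !IH scalerDr addrACA.
Qed.

Lemma coact_linl a x y f : S x -> S y -> coact (a *: x + y) f = a *: coact x f + coact y f.
Proof.
move=> Sx Sy; apply/funext => j.
rewrite -[RHS]/(a *: coact x f j + coact y f j).
elim: j x y f Sx Sy => [|j IH] x y f Sx Sy /=; first by rewrite (rep_linl rhoR).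
by rewrite liebDr liebZr !IH; [rewrite scalerDr addrACA|..]; try apply: eS.
Qed.

Lemma coact_shift y f : shift (coact y f) = coact (lieb e y) f + coact y (shift f).
Proof. by []. Qed.

Lemma coactS y f j : coact y f j.+1 = coact (lieb e y) f j + coact y (shift f) j.
Proof. by []. Qed.

Lemma coact_br x y f j : S x -> S y ->
  coact (lieb x y) f j = coact x (coact y f) j - coact y (coact x f) j.
Proof.
elim: j x y f => [|j IH] x y f Sx Sy; first exact: (rep_br rhoR).
have linD z u v : coact z (u + v) j = coact z u j + coact z v j.
  by have := coact_linr z 1 u v; rewrite !scale1r => ->.
have Sex := eS Sx; have Sey := eS Sy.
have exy : lieb e (lieb x y) = 1 *: lieb (lieb e x) y + lieb x (lieb e y).
  by rewrite scale1r lieb_leibniz subrK.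
rewrite coactS exy coact_linl; [|exact: bS|exact: bS].
rewrite scale1r -[(_ + _) j]/(coact (lieb (lieb e x) y) f j + coact (lieb x (lieb e y)) f j).
rewrite (IH _ _ _ Sex Sy) (IH _ _ _ Sx Sey) (IH _ _ _ Sx Sy).
rewrite [coact x (coact y f) _]coactS [coact y (coact x f) _]coactS.
rewrite (coact_shift x) (coact_shift y) !linD.
rewrite !opprD !addrA; by rewrite [LHS](ACl (1*3*5*4*2*6)).
Qed.

Lemma shift_linear : linear shift.
Proof. by []. Qed.

Local Notation S1 := [set x | exists y a, S y /\ x = y + a *: e]%classic.

(** Since [e] is not in [S], the coefficient of [e] is well defined on [S + K e]. *)
Lemma coefficient_exists : exists dec : L -> K, forall y a, S y -> dec (y + a *: e) = a.
Proof.
pose P x a := exists2 y, S y & x = y + a *: e.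
exists (fun x => if pselect (exists a, P x a) is left h then projT1 (cid h) else 0).
move=> y a Sy; case: pselect => [h|[]]; last by exists a, y.
case: cid => b /= [z Sz yzE]; apply/eqP/negPn/negP => ba; apply: enS.
have {yzE} Sab : S ((a - b) *: e).
  have -> : (a - b) *: e = z - y.
    by rewrite scalerBl; apply/eqP; rewrite subr_eq addrAC -yzE addrC addKr.
  exact: subspaceB.
have := subspaceZ (a - b)^-1 sS Sab.
by rewrite scalerA mulVf ?scale1r // subr_eq0 eq_sym.
Qed.

Lemma coinduced_rep : exists rho1 : L -> (nat -> M) -> (nat -> M),
  lie_rep S1 rho1 /\
  forall y a f, S y -> rho1 (y + a *: e) f = coact y f + a *: shift f.
Proof.
have [dec decE] := coefficient_exists.
pose rho1 x (f : nat -> M) := coact (x - dec x *: e) f + dec x *: shift f.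
have rhoE y a f : S y -> rho1 (y + a *: e) f = coact y f + a *: shift f.
  by move=> Sy; rewrite /rho1 decE // addrK.
exists rho1; split=> //; split=> [x a f h|a x x' f|x x' f].
- rewrite /rho1 coact_linr (shift_linear a f h) !scalerDr addrACA.
  by rewrite !scalerA [dec x * a]mulrC.
- move=> [y [b [Sy ->]]] [y' [b' [Sy' ->]]].
  have -> : a *: (y + b *: e) + (y' + b' *: e) = (a *: y + y') + (a * b + b') *: e.
    by rewrite scalerDr scalerDl scalerA addrACA.
  rewrite !rhoE //; last exact: sS.2.
  by rewrite coact_linl // scalerDl scalerDr scalerA addrACA.
move=> [y [b [Sy ->]]] [y' [b' [Sy' ->]]].
have Sey := eS Sy; have Sey' := eS Sy'.
have -> : lieb (y + b *: e) (y' + b' *: e) =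
    (b *: lieb e y' + ((- b') *: lieb e y + lieb y y')) + 0 *: e.
  rewrite scale0r addr0 !(liebDl, liebDr) !(liebZl, liebZr) liebxx scaler0 scaler0 addr0.
  by rewrite (lieb_anti y e) scalerN scaleNr addrC; congr (_ + _); rewrite addrC.
have S2 : S ((- b') *: lieb e y + lieb y y') by apply: sS.2 => //; apply: bS.
rewrite !rhoE //; last exact: sS.2.
rewrite !coact_linl //; last exact: bS.
rewrite scale0r addr0.
have linP z a u v : coact z (u + a *: v) = coact z u + a *: coact z v.
  by rewrite addrC coact_linr addrC.
have shiftP a (u v : nat -> M) : shift (u + a *: v) = shift u + a *: shift v by [].
have -> : coact (lieb y y') f = coact y (coact y' f) - coact y' (coact y f).
  by apply/funext => j; apply: coact_br.
rewrite !linP !shiftP !coact_shift !scalerDr !scalerA [b' * b]mulrC scaleNr.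
rewrite !opprD !addrA.
move: (coact y _) (coact y' _) (b *: coact y' _) (b' *: coact y _) (_ *: shift _).
move: (b *: _) (b' *: _) => A B P Q X Y Z.
by rewrite [RHS](ACl ((2*9)*(4*7)*(5*10)*3*8*1*6)) /= !subrr !add0r.
Qed.

(** The value at [0] of [y f] is [y (f 0)], and that of [e f] is [f 1]. These two
    values of [f] can be chosen independently, so [y + a e] acts as zero only if
    [a = 0] and [y] acts as zero on [M]. *)
Lemma coinduced_faithful :
  (exists m : M, m != 0) -> (forall x, S x -> (forall m, rho x m = 0) -> x = 0) ->
  has_faithful_rep S1.
Proof.
move=> [m m0] fth; have [rho1 [rho1R rho1E]] := coinduced_rep.
exists (nat -> M), rho1; split=> //.
  exists (fun=> m); apply/eqP => /(congr1 (fun f => f 0%N)) /= /eqP.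
  by rewrite (negPf m0).
move=> _ [y [a [Sy ->]]] h0.
have h f : rho y (f 0%N) + a *: f 1%N = 0.
  by have := congr1 (fun u => u 0%N) (h0 f); rewrite rho1E.
have rho0 : rho y 0 = 0.
  by have := rep_linr rhoR y (-1) 0 0; rewrite !scaleN1r !addNr.
have a0 : a = 0.
  have /= := h (fun j => if j is 0%N then 0 else m).
  by rewrite rho0 add0r => /eqP; rewrite scaler_eq0 (negPf m0) orbF => /eqP.
rewrite a0 scale0r addr0; apply: fth => // u.
by have := h (fun=> u); rewrite a0 scale0r addr0.
Qed.

End Coinduction.

(** Birkhoff's embedding theorem: a chain of ideals with one-dimensional quotients
    refining the lower central series is climbed by coinduction. *)
Theorem nilpotent_faithful (K : fieldType) (g : lieVectType K) r :
  (forall x, lcs g r.+1 x -> x = 0) -> has_faithful_rep [set: g].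
Proof.
move=> g0.
suff H k : (k <= r)%N -> has_faithful_rep (lcs g (r.+1 - k)).
  by have := H r (leqnn r); rewrite subSnn.
elim: k => [|k IH] kr.
  rewrite subn0; exists K^o, (fun _ _ => 0); split.
  - split=> [x a u v|a x y m|x y m] *; first by rewrite scaler0 addr0.
      by rewrite scaler0 addr0.
    by rewrite subr0.
  - by exists 1; rewrite oner_neq0.
  - by move=> x /g0.
have {IH} := IH (ltnW kr); set i := (r.+1 - k.+1)%N.
have -> : (r.+1 - k)%N = i.+1 by rewrite /i; lia.
move: {kr} i => i hB.
have climb (s : seq g) : {in s, forall x, lcs g i x} ->
    has_faithful_rep [set x | x \in (vspan (lcs g i.+1) + <<s>>)%VS].
  elim: s => [|e s IH] se.
    move: hB; congr has_faithful_rep; apply/seteqP; split=> x /=;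
      rewrite span_nil addv0 (vspan_subspaceP _ (lcs_subspace g i.+1)) //.
  have [x xs|M [rho [rhoR M0 fth]]] := IH; first by apply: se; rewrite inE xs orbT.
  set U := (_ + _)%VS in rhoR fth.
  have -> : (vspan (lcs g i.+1) + <<e :: s>>)%VS = (U + <[e]>)%VS.
    by rewrite span_cons [(<[e]> + _)%VS]addvC addvA.
  have sU : subspace [set x | x \in U].
    by split=> [|a x y xU yU]; rewrite /= ?mem0v // memvD // memvZ.
  have Usub x : x \in U -> lcs g i x.
    move=> /memv_addP[u uB [v vs ->]]; apply: (subspaceD (lcs_subspace g i)).
      apply: (@lcs_decrS _ _ i).
      by apply/(vspan_subspaceP _ (lcs_subspace g i.+1)).
    apply/(vspan_subspaceP _ (lcs_subspace g i)); move: v vs; apply/subvP/span_subvP.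
    move=> w ws; apply/(vspan_subspaceP _ (lcs_subspace g i)).
    by apply: se; rewrite inE ws orbT.
  have brU x y : y \in U -> lieb x y \in U.
    move=> /Usub/(@lcs_lieb _ _ _ x) h; apply: (subvP (addvSl _ _)).
    exact/(vspan_subspaceP _ (lcs_subspace g i.+1)).
  have [eU|eU] := boolP (e \in U).
    exists M, rho; have -> : (U + <[e]>)%VS = U by apply/addv_idPl.
    by [].
  have -> : [set x | x \in (U + <[e]>)%VS]%classic =
      [set x | exists y a, [set x | x \in U]%classic y /\ x = y + a *: e]%classic.
    apply/seteqP; split=> x /=.
      by move=> /memv_addP[u uU [_ /vlineP[a ->] ->]]; exists u, a.
    by move=> [u [a [uU ->]]]; rewrite memv_add // memvZ // memv_line.
  apply: coinduced_faithful rhoR M0 fth => // [x y xU yU|y yU|]; try exact: brU.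
  exact/negP.
have := climb (vbasis (vspan (lcs g i))).
have -> : [set x | x \in (vspan (lcs g i.+1) + <<vbasis (vspan (lcs g i))>>)%VS]%classic
    = lcs g i.
  have sp := lcs_subspace g i.
  rewrite (span_basis (vbasisP _)); apply/seteqP; split=> x /=; last first.
    move=> h; apply: (subvP (addvSr _ _)); exact/(vspan_subspaceP _ sp).
  rewrite (addv_idPr _) ?(vspan_subspaceP _ sp) //.
  by apply/vspan_sub => y /lcs_decrS h; apply/(vspan_subspaceP _ sp).
apply=> x /vbasis_mem xU; exact/(vspan_subspaceP _ (lcs_subspace g i)).
Qed.

(** * Free Lie algebras and words *)

Section CommutatorAlgebra.
Variables (K : fieldType) (A : algType K).

Definition comm_lie : Type := A.
HB.instance Definition _ := GRing.Lmodule.on comm_lie.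

Definition commr (x y : A) : A := x * y - y * x.

Lemma commr_linl y : linear (commr^~ y).
Proof.
move=> a u v; rewrite /commr mulrDl mulrDr -scalerAl -scalerAr opprD addrACA.
by rewrite -scalerBr.
Qed.
Lemma commr_linr y : linear (commr y).
Proof.
move=> a u v; rewrite /commr mulrDl mulrDr -scalerAl -scalerAr opprD addrACA.
by rewrite -scalerBr.
Qed.
Lemma commrxx x : commr x x = 0.
Proof. exact: subrr. Qed.
Lemma commr_jacobi x y z :
  commr x (commr y z) + commr y (commr z x) + commr z (commr x y) = 0.
Proof.
rewrite /commr !(mulrBl, mulrBr) !mulrA !opprB !addrA.
rewrite [LHS](ACl ((1*12)*(7*2)*(3*10)*(5*4)*(11*6)*(9*8))) /=.
by rewrite !subrr !addr0.
Qed.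

HB.instance Definition _ :=
  isLie.Build K comm_lie commr_linl commr_linr commrxx commr_jacobi.

(** The element [f x] of [A] is recovered from this module as the action of [x] on
    [1], so that what holds in every module holds in [A]. *)
Lemma left_mul_rep (L : lieAlgType K) (f : L -> comm_lie) :
  lie_morphism f -> lie_rep [set: L]%classic (fun x (m : A) => (f x : A) * m).
Proof.
move=> fM; split=> [x a u v|a x y m _ _|x y m _ _].
- by rewrite mulrDr -scalerAr.
- by rewrite fM.1 mulrDl -scalerAl.
by rewrite fM.2 [lieb _ _]/(commr _ _) /commr mulrBl !mulrA.
Qed.

End CommutatorAlgebra.

Section Words.
Variables (K : fieldType) (n : nat).
Local Notation L := (freeLie K n).
Local Notation x := (@fl_gen K n).
Implicit Types (cs : seq (K * seq 'I_n)) (w v : seq 'I_n) (u : L).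

Definition wact (M : lmodType K) (rho : L -> M -> M) w (m : M) : M :=
  foldr (fun i => rho (x i)) m w.

(** The noncommutative polynomial [cs] represents [u] in the universal enveloping
    algebra. Quantifying over all representations spares the construction of the
    latter. *)
Definition expands cs u : Prop :=
  forall (M : lmodType K) (rho : L -> M -> M), lie_rep [set: L]%classic rho ->
  forall m, rho u m = \sum_(p <- cs) p.1 *: wact rho p.2 m.

Definition coef cs w : K := \sum_(p <- cs | p.2 == w) p.1.

Lemma wact_cat (M : lmodType K) (rho : L -> M -> M) w v m :
  wact rho (w ++ v) m = wact rho w (wact rho v m).
Proof. exact: foldr_cat. Qed.

Lemma wact_lin (M : lmodType K) (rho : L -> M -> M) :
  lie_rep [set: L]%classic rho -> forall w, linear (wact rho w).
Proof.
move=> rR; elim=> // i w IH a m m'.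
by rewrite -[LHS]/(rho (x i) (wact rho w _)) IH (rep_linr rR).
Qed.

Lemma lin_sum (M : lmodType K) (h : M -> M) (I : Type) (s : seq I) (a : I -> K) F :
  linear h -> h (\sum_(p <- s) a p *: F p) = \sum_(p <- s) a p *: h (F p).
Proof.
move=> lh; elim: s => [|p s IH]; last by rewrite !big_cons lh IH.
by rewrite !big_nil; have := lh (-1) 0 0; rewrite !scaleN1r !addNr.
Qed.

Definition cs_mul cs cs' := [seq (p.1 * q.1, p.2 ++ q.2) | p <- cs, q <- cs'].

Definition cs_br cs cs' := cs_mul cs cs' ++ [seq (- p.1, p.2) | p <- cs_mul cs' cs].

Lemma expands_br cs cs' u u' :
  expands cs u -> expands cs' u' -> expands (cs_br cs cs') (lieb u u').
Proof.
move=> hu hu' M rho rR m; rewrite (rep_br rR) // big_cat big_map /=.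
have mulE ds ds' t t' : expands ds t -> expands ds' t' ->
    rho t (rho t' m) = \sum_(p <- cs_mul ds ds') p.1 *: wact rho p.2 m.
  move=> ht ht'; rewrite (ht _ _ rR) [RHS]big_allpairs_dep /=; apply: eq_bigr => p _.
  rewrite (ht' _ _ rR) lin_sum; last exact: wact_lin.
  by rewrite scaler_sumr; apply: eq_bigr => q _; rewrite wact_cat scalerA.
rewrite (mulE _ _ _ _ hu hu') (mulE _ _ _ _ hu' hu); congr (_ + _).
by rewrite -sumrN; apply: eq_bigr => p _; rewrite scaleNr.
Qed.

Lemma expands_gen i : expands [:: (1, [:: i])] (x i).
Proof. by move=> M rho rR m; rewrite big_seq1 /= scale1r. Qed.

Lemma homog_expands d u : homog x d u ->
  exists2 cs, expands cs u & {in cs, forall p, size p.2 = d}.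
Proof.
move: u; apply: (@lspan_min _ _ _
  (fun u => exists2 cs, expands cs u & {in cs, forall p, size p.2 = d})).
  split.
    exists [::] => // M rho rR m; rewrite big_nil.
    by have := rep_linl rR (-1) m (I : setT 0) (I : setT 0);
      rewrite scaleN1r oppr0 addr0 scaleN1r addNr.
  move=> a u u' [cs hu cd] [cs' hu' cd'].
  exists ([seq (a * p.1, p.2) | p <- cs] ++ cs').
    move=> M rho rR m; rewrite (rep_linl rR) // hu // hu' // big_cat big_map /=.
    by congr (_ + _); rewrite scaler_sumr; apply: eq_bigr => p _; rewrite scalerA.
  by move=> p; rewrite mem_cat => /orP[/mapP[q /cd <- ->]|/cd'].
move=> u; elim=> {d u} [i|d e u v _ [cs hu cd] _ [cs' hv cd']].
  exists [:: (1, [:: i])]; first exact: expands_gen.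
  by move=> p; rewrite inE => /eqP->.
exists (cs_br cs cs'); first exact: expands_br.
have md ds ds' k k' : {in ds, forall p, size p.2 = k} ->
    {in ds', forall p, size p.2 = k'} -> {in cs_mul ds ds', forall p, size p.2 = (k + k')%N}.
  by move=> hk hk' _ /allpairsP[q [/hk + /hk' + ->]] /=; rewrite size_cat => -> ->.
move=> p; rewrite mem_cat => /orP[|/mapP[p' + ->]]; first exact: md.
by rewrite addnC; apply: md.
Qed.

Lemma sum_coef (M : lmodType K) cs (F : seq 'I_n -> M) :
  \sum_(p <- cs) p.1 *: F p.2 = \sum_(w <- undup (map snd cs)) coef cs w *: F w.
Proof.
under [RHS]eq_bigr => w _ do rewrite /coef scaler_suml.
rewrite (exchange_big_dep predT) //= big_seq [RHS]big_seq; apply: eq_bigr => p pc.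
rewrite -big_filter (@eq_filter _ _ (pred1 p.2)) => [|w]; last exact: eq_sym.
by rewrite filter_pred1_uniq ?undup_uniq ?mem_undup ?map_f // big_seq1.
Qed.

(** A Lie element without coefficients acts trivially in every representation, in
    particular in a faithful one of the free nilpotent algebra. *)
Lemma coef0_nq cs u r : expands cs u -> (forall w, coef cs w = 0) -> nq_pi r u = 0.
Proof.
move=> hu c0.
have [M [rho [rR _ fth]]] := @nilpotent_faithful K (freeNil K n r) r (@freeNil_lcs_eq0 K n r).
apply: fth => // m.
have qM := nq_pi_morph L r.
have qR : lie_rep [set: L]%classic (fun u => rho (nq_pi r u)).
  split=> [t|a t t' m' _ _|t t' m' _ _]; first exact: (rep_linr rR).
    by rewrite qM.1 (rep_linl rR).
  by rewrite qM.2 (rep_br rR).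
by rewrite (hu _ _ qR) sum_coef big1 // => w _; rewrite c0 scale0r.
Qed.

(** The representation in which the generators move along the path labelled by [v]:
    its matrices are strictly upper triangular, and the corner entry of a word of
    length [size v] tells whether this word is [v]. *)
Section Path.
Variable v : seq 'I_n.
Local Notation N := (size v).

(* The second condition says that [v] has a letter number [k] and that it is [i]. *)
Definition path_mx i : 'M[K]_N.+1 :=
  \matrix_(k, l) ((l == k.+1 :> nat) && (take 1 (drop k v) == [:: i]))%:R.

Lemma path_mx_word w (k l : 'I_N.+1) :
  (foldr (fun i => *%R (path_mx i)) 1 w) k l =
    ((k <= l)%N && (drop k (take l v) == w))%:R.
Proof.
elim: w k => [|i w IH] k /=.
  rewrite mxE; congr (_%:R); rewrite -val_eqE /= -size_eq0 size_drop.
  by rewrite size_takel ?leq_ord // subn_eq0 eqn_leq; case: ltngtP.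
rewrite mxE; have [kN|kN] := ltnP k N; last first.
  rewrite big1 => [|j _]; last by rewrite mxE drop_oversize // andbF mul0r.
  rewrite drop_oversize ?andbF //.
  by rewrite size_takel ?leq_ord //; apply: leq_trans kN; apply: leq_ord.
rewrite (bigD1 (Ordinal (kN : (k.+1 < N.+1)%N))) //= big1 ?addr0; last first.
  by move=> j /negPf; rewrite -val_eqE /= mxE => ->; rewrite mul0r.
rewrite mxE IH /= eqxx /= -natrM mulnb; congr (_%:R).
have [kl|lk] := ltnP k l; last first.
  by rewrite [drop k (take l v)]drop_oversize ?andbF // size_takel // leq_ord.
rewrite (ltnW kl) /= (drop_nth i kN) /= take0 (@drop_nth _ i k (take l v)); last first.
  by rewrite size_takel ?leq_ord.
by rewrite nth_take // !eqseq_cons andbT.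
Qed.

Lemma path_rep : exists f : L -> comm_lie 'M[K]_N.+1, [/\ lie_morphism f,
  forall cs u, expands cs u -> f u ord0 ord_max = coef cs v &
  forall u, lcs L N.+1 u -> f u = 0].
Proof.
have [f [fM fg _]] := @fl_universal K n (comm_lie 'M[K]_N.+1) path_mx.
exists f; split=> // [cs u hu|u].
  have := hu _ _ (left_mul_rep fM) 1; rewrite mulr1 => ->.
  rewrite summxE /coef [RHS]big_mkcond; apply: eq_bigr => p _; rewrite mxE.
  have -> : wact (fun t (m : 'M[K]_N.+1) => (f t : 'M_N.+1) * m) p.2 1 =
      foldr (fun i => *%R (path_mx i)) 1 p.2.
    by rewrite /wact; elim: p.2 => //= i w ->; rewrite fg.
  rewrite path_mx_word /= drop0 take_size eq_sym.
  by case: eqP; rewrite ?mulr1 ?mulr0.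
pose T k : set L := [set u | forall i j : 'I_N.+1, (j < i + k)%N -> f u i j = 0]%classic.
have sT k : subspace (T k).
  split=> [i j _|a t t' ht ht' i j ij]; first by rewrite (lmorph0 fM) mxE.
  by rewrite fM.1 !mxE ht // ht' // mulr0 addr0.
have bT k k' t t' : T k t -> T k' t' -> T (k + k')%N (lieb t t').
  move=> ht ht' i j ij; rewrite fM.2 !mxE !big1 ?subr0 // => l _.
    have [li|il] := ltnP l (i + k'); first by rewrite ht' ?mul0r.
    by rewrite ht ?mulr0 //; lia.
  have [li|il] := ltnP l (i + k); first by rewrite ht ?mul0r.
  by rewrite ht' ?mulr0 //; lia.
have T1 t : T 1%N t.
  move: t; apply: fl_ind => // [t t' ht ht'|i k j kj].
    by move=> i j ij; apply: (bT _ _ _ _ ht ht'); lia.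
  by rewrite fg mxE (_ : (_ == _) = false) //; apply/eqP; lia.
have Tlcs k t : lcs L k.+1 t -> T k.+1 t.
  elim: k t => [|k IH] t; first by move=> _; apply: T1.
  rewrite lcsSS; move: t; apply: lspan_min => // _ [t [t' [/IH ht' ->]]].
  by rewrite -add1n; apply: bT.
by move=> /Tlcs h; apply/matrixP => i j; rewrite h ?mxE //; have := ltn_ord j; lia.
Qed.

End Path.

Lemma homog_lcs d u : homog x d u -> lcs L d u.
Proof.
by apply: lspan_min; [exact: lcs_subspace|move=> t /lie_monomial_lcs[]].
Qed.

Lemma coef_size cs w d : {in cs, forall p, size p.2 = d} -> size w != d -> coef cs w = 0.
Proof.
move=> cd wd; rewrite /coef big_seq_cond big_pred0 // => p.
by apply/negP => /andP[/cd + /eqP pw]; rewrite pw => /eqP; rewrite (negPf wd).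
Qed.

(** The coefficients of [u] on words of length [d] are read off in the
    representations [path_rep], which kill [lcs L d.+1]. *)
Lemma homog_nq0 d u r : homog x d u -> lcs L d.+1 u -> nq_pi r u = 0.
Proof.
move=> /homog_expands[cs hu cd] ud; apply: (coef0_nq r hu) => w.
have [wd|] := eqVneq (size w) d; last exact: coef_size.
have [f [_ fc f0]] := path_rep w.
by rewrite -(fc _ _ hu) f0 ?mxE // wd.
Qed.

(** Induction on the degree: the leading homogeneous part of a bracket is the bracket
    of the leading parts. *)
Lemma lcs_homog d u : lcs L d.+1 u ->
  exists2 h, homog x d.+1 h & lcs L d.+2 (u - h).
Proof.
pose T d u := exists2 h, homog x d.+1 h & lcs L d.+2 (u - h).
have sT d' : subspace (T d').
  split.
    exists 0; first exact: (lspan_subspace _).1.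
    by rewrite subr0; exact: (lcs_subspace _ _).1.
  move=> a t t' [h hh ht] [h' hh' ht']; exists (a *: h + h').
    exact: (lspan_subspace _).2.
  by rewrite opprD addrACA -scalerBr; apply: (lcs_subspace _ _).2.
have T0 t : T 0%N t.
  move: t; apply: fl_ind => // [t t' _ _|i].
    exists 0; first exact: (lspan_subspace _).1.
    by rewrite subr0; apply: (@lcs_lieb _ _ 1).
  exists (x i); last by rewrite subrr; exact: (lcs_subspace _ _).1.
  by apply: lspan_sub; apply: LieMonGen.
have brH h h' d' : homog x 1 h -> homog x d' h' -> homog x d'.+1 (lieb h h').
  have sH k : subspace (homog x k) by exact: lspan_subspace.
  move=> hh hh'; move: h hh; apply: (@lspan_min _ _ _ (fun h => homog x d'.+1 (lieb h h'))).
    split=> [|a t t' ht ht']; first by rewrite lieb0l; apply: (sH _).1.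
    by rewrite liebDl liebZl; apply: (sH _).2.
  move=> h mh; move: h' hh'; apply: (@lspan_min _ _ _ (fun h' => homog x d'.+1 (lieb h h'))).
    split=> [|a t t' ht ht']; first by rewrite lieb0r; apply: (sH _).1.
    by rewrite liebDr liebZr; apply: (sH _).2.
  by move=> h' mh'; apply: lspan_sub; apply: (LieMonBracket mh mh').
elim: d u => [|d IH] u; first by move=> _; apply: T0.
rewrite lcsSS; move: u; apply: (@lspan_min _ _ _ (T d.+1)) => // _ [t [t' [ht' ->]]].
have [h hh th] := T0 t; have [h' hh' th'] := IH _ ht'.
exists (lieb h h'); first exact: brH.
have -> : lieb t t' - lieb h h' = lieb (t - h) t' + lieb h (t' - h').
  by rewrite liebDl liebDr liebNl liebNr addrA subrK.
apply: (subspaceD (lcs_subspace L d.+3)).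
  by have := lcs_liebD th ht'.
exact: (@lcs_lieb _ _ d.+2).
Qed.

(** The centraliser of a generator in the free Lie algebra. If [[x i, u]] has no
    coefficients, those of [u] are invariant under rotating an [i] from the end of a
    word to its front, and vanish on the words not ending in [i]; only the power of
    [x i] can survive, and a commutator has no coefficient there. *)
Lemma ad_gen_inj (i : 'I_n) p (z : freeNil K n p.+1) : (1 < p)%N ->
  lcs (freeNil K n p.+1) p z -> lieb (@fn_gen K n p.+1 i) z = 0 ->
  lcs (freeNil K n p.+1) p.+1 z.
Proof.
case: p z => [|[|p]] // z _.
have qM := nq_pi_morph L p.+3.
have qS y : exists t, nq_pi p.+3 t = y :> nilquot L p.+3.
  by elim/nq_piW: y => t; exists t.
move=> /(lcs_morph_onto qM qS)[u0 hu0 <-]; rewrite /fn_gen -qM.2 => /nq_pi_eq0 br0.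
have [u hu uu0] := lcs_homog hu0.
suff u00 : nq_pi p.+3 u = 0.
  by rewrite -[u0](subrK u) (lmorphD qM) u00 addr0; apply: (lcs_morph qM).
have {}br0 : lcs L p.+4 (lieb (x i) u).
  rewrite -[u](subKr u0) liebDr liebNr; apply: (subspaceB (lcs_subspace _ _)) => //.
  exact: (@lcs_lieb _ _ p.+3).
have [cs hcs cd] := homog_expands hu.
have hbr := expands_br (expands_gen i) hcs; set bs := cs_br _ _ in hbr.
have coefbr v : coef bs v = (if ohead v == Some i then coef cs (behead v) else 0) -
    (if ohead (rev v) == Some i then coef cs (rev (behead (rev v))) else 0).
  rewrite /bs /cs_br /coef big_cat /= big_map /=.
  congr (_ + _).
    rewrite /cs_mul /= cats0 big_map /=; case: v => [|j v] /=.
      by rewrite big_pred0.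
    rewrite (_ : (Some j == Some i) = (j == i)) //.
    have [->|ji] := eqVneq j i; last first.
      by rewrite big_pred0 // => q; rewrite eqseq_cons eq_sym (negPf ji).
    by apply: eq_big => q; rewrite ?eqseq_cons ?eqxx ?mul1r.
  rewrite sumrN; congr (- _).
  rewrite big_mkcond big_allpairs_dep /=.
  under eq_bigr => q _ do rewrite big_seq1 mulr1 /=.
  rewrite -big_mkcond; case/lastP: v => [|v j].
    by rewrite big_pred0 // => q; case: (q.2).
  rewrite rev_rcons /= revK (_ : (Some j == Some i) = (j == i)) //.
  have [->|ji] := eqVneq j i; last first.
    by rewrite big_pred0 // => q; rewrite cats1 eqseq_rcons [i == j]eq_sym (negPf ji) andbF.
  by apply: eq_bigl => q; rewrite cats1 eqseq_rcons eqxx andbT.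
have bs0 v : coef bs v = 0.
  have [vp|vp] := eqVneq (size v) p.+3.
    have [f [_ fc f0]] := path_rep v.
    by rewrite -(fc _ _ hbr) f0 ?mxE // vp.
  rewrite coefbr; case: v vp => [|j v] vp /=; first by rewrite subrr.
  have h w : size w = size v -> coef cs w = 0.
    by move=> wv; apply: (coef_size cd); rewrite wv; apply: contra vp => /= /eqP->.
  by rewrite !h ?if_same ?subrr // size_rev size_behead size_rev.
(* A letter [i] moves from the end of a word to its front without changing the
   coefficient; once the last letter is not [i], the coefficient vanishes. *)
have rot k w : ~~ all (pred1 i) w -> coef cs (nseq k i ++ w) = 0.
  elim/last_ind: w k => // w j IH k; rewrite all_rcons negb_and => /= jw.
  have := bs0 (i :: nseq k i ++ rcons w j); rewrite coefbr /= eqxx.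
  rewrite -rcons_cat -rcons_cons rev_rcons /= (_ : (Some j == Some i) = (j == i)) //.
  case: eqP jw => [-> /= wi|_ _]; last by rewrite subr0.
  by rewrite revK -cat_cons -[i :: _]/(nseq k.+1 i) IH // subr0.
(* The coefficient of the power of [x i] is the value of [u] in the commutative
   algebra where the other generators vanish. *)
have [f [fM fg _]] := @fl_universal K n (comm_lie K^o) (fun j => (j == i)%:R).
have f0 : f u = 0.
  have f2 : (lcs L 2 `<=` [set t | f t = 0])%classic.
    rewrite lcsSS; apply: lspan_min; first exact: (ker_ideal fM).1.
    by move=> _ [t [t' [_ ->]]] /=; rewrite fM.2 [lieb _ _]/(commr _ _) /commr mulrC subrr.
  by apply: f2; apply: (lcs_decr (_ : (2 <= p.+2)%N)); last exact: homog_lcs.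
apply: (coef0_nq _ hcs) => w.
have [ws|] := eqVneq (size w) p.+2; last exact: (coef_size cd).
have [|wi] := boolP (all (pred1 i) w); last exact: (rot 0%N).
move=> /all_pred1P ->; have := hcs _ _ (left_mul_rep fM) 1.
rewrite f0 mul0r => /esym <-; rewrite /coef big_mkcond big_seq [RHS]big_seq.
apply: eq_bigr => q /cd qs.
have -> : wact (fun t (m : K^o) => (f t : K^o) * m) q.2 1 = (all (pred1 i) q.2)%:R.
  by rewrite /wact; elim: (q.2) => //= j v ->; rewrite fg -natrM mulnb.
rewrite (_ : (q.2 == _) = all (pred1 i) q.2).
  by case: ifP; rewrite ?scaler0 // [_ *: _]mulr1.
by rewrite ws -qs; apply/eqP/all_pred1P.
Qed.

End Words.

(** * Dimensions in free nilpotent Lie algebras *)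

Section FreeNilpotentDimensions.
Variables (K : fieldType) (n r : nat).
Local Notation F := (freeNil K n r).
Local Notation x := (@fn_gen K n r).

(** The grading of the free Lie algebra survives in its nilpotent quotients. *)
Lemma fn_homog_lcs d (y : F) : (d <= r)%N -> homog x d y -> lcs F d.+1 y -> y = 0.
Proof.
move=> dr hy yd; have qM := nq_pi_morph (freeLie K n) r.
have qS z : exists u, nq_pi r u = z :> F by elim/nq_piW: z => u; exists u.
have [u hu uy] : exists2 u, homog (@fl_gen K n) d u & nq_pi r u = y :> F.
  move: y hy {yd}; apply: (@lspan_min _ _ _
    (fun y => exists2 u, homog (@fl_gen K n) d u & nq_pi r u = y :> F)).
    have sp := lspan_subspace (lie_monomial (@fl_gen K n) d).
    split; first by exists 0; [exact: sp.1|].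
    move=> a _ _ [u hu <-] [v hv <-]; exists (a *: u + v); first exact: sp.2.
    by rewrite qM.1.
  move=> y my; suff [u] : exists2 u, lie_monomial (@fl_gen K n) d u & nq_pi r u = y :> F.
    by exists u => //; apply: lspan_sub.
  elim: my => {d dr y} [i|d e _ _ _ [u hu <-] _ [v hv <-]].
    by exists (fl_gen K i) => //; apply: LieMonGen.
  by exists (lieb u v); [apply: LieMonBracket|rewrite qM.2].
have [v hv vy] := lcs_morph_onto qM qS yd.
rewrite -uy; apply: homog_nq0 hu _.
have -> : u = (u - v) + v by rewrite subrK.
apply: (subspaceD (lcs_subspace _ _)) => //; apply: (lcs_decr (_ : d < r.+1)%N) => //.
by apply/nq_piP; rewrite uy vy.
Qed.

(** The elements whose brackets with [A] lie in the right-hand side form a subalgebra,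
    by the Leibniz rule. *)
Lemma brs_gens (A : set F) : lie_ideal A ->
  (brs A `<=` lspan [set z | exists i a, A a /\ z = lieb (x i) a])%classic.
Proof.
move=> [sA bA]; set G := [set z | _]%classic; have sG := lspan_subspace G.
apply: lspan_min => // _ [y [a [Aa ->]]].
move: y a Aa; apply: (@fn_ind _ _ _ (fun y => forall a, A a -> lspan G (lieb y a))).
- split=> [a _|b y z hy hz a Aa]; first by rewrite lieb0l; apply: sG.1.
  by rewrite liebDl liebZl; apply: sG.2; [apply: hy|apply: hz].
- move=> y z hy hz a Aa; rewrite lieb_leibniz; apply: (subspaceB sG).
    by apply: hy; apply: bA.
  by apply: hz; apply: bA.
by move=> i a Aa; apply: lspan_sub; exists i, a.
Qed.

(** Modulo [[F, B]], the brackets with [A] are spanned by those of the generators with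
    a complement of [B] in [A]. *)
Lemma sdim_brs (A B : set F) : lie_ideal A -> lie_ideal B -> (B `<=` A)%classic ->
  (sdim (brs A) <= sdim (brs B) + n * (sdim A - sdim B))%N.
Proof.
move=> iA iB BA; set W := (vspan A :\: vspan B)%VS.
have BAv : (vspan B <= vspan A)%VS.
  by apply: vspan_sub => y /BA Ay; apply/(vspan_subspaceP _ iA.1).
have dW : \dim W = (sdim A - sdim B)%N.
  by have := dimv_cap_compl (vspan A) (vspan B); rewrite (capv_idPr BAv) -/W /sdim; lia.
have adP (y : F) : exists h : 'End(F), forall z, h z = lieb y z.
  pose lM := GRing.isLinear.Build K F F *:%R (lieb y) (lieb_linearr y).
  pose G : {linear F -> F} := HB.pack (lieb y) lM.
  by exists (linfun G) => z; rewrite lfunE.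
pose ad y := projT1 (cid (adP y)).
have adE y z : ad y z = lieb y z by rewrite /ad; case: cid.
apply: (@leq_trans (\dim (vspan (brs B) + \sum_(i < n) (ad (x i) @: W))%VS)).
  apply/dimvS/subvP => y /(vspan_subspaceP _ (brs_subspace A))/(brs_gens iA).
  move: y; apply: (@lspan_min _ _ _ (fun y => y \in _)).
    by split=> [|a y z yU zU]; rewrite ?mem0v // memvD // memvZ.
  move=> _ [i [a [Aa ->]]].
  have : a \in vspan A by apply/(vspan_subspaceP _ iA.1).
  rewrite -(addv_diff_cap (vspan A) (vspan B)) => /memv_addP[w wW [b bB ->]].
  rewrite liebDr addrC; apply: memv_add.
    apply/(vspan_subspaceP _ (brs_subspace B)); apply: brs_lieb.
    by move: bB; rewrite memv_cap => /andP[_ /(vspan_subspaceP _ iB.1)].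
  by apply: (subvP (sumv_sup i _ (subvv _))) => //; rewrite -adE memv_img.
apply: leq_trans (dimv_add_leqif _ _) _; rewrite leq_add2l.
apply: leq_trans (dimv_leq_sum _ _ _) _.
rewrite -dW -[X in (X * _)%N](card_ord n) -sum_nat_const; apply: leq_sum => i _.
by rewrite -(limg_ker_dim (ad (x i)) W) leq_addl.
Qed.

(** The degree two part is spanned by the brackets of two generators in increasing
    order. *)
Lemma sdim_lcs2 : (sdim (lcs F 2) <= sdim (lcs F 3) + 'C(n, 2))%N.
Proof.
pose low (j : 'I_n) (i : 'I_j) := x (widen_ord (ltnW (ltn_ord j)) i).
pose U := (vspan (lcs F 3) + \sum_(j < n) \sum_(i < j) <[lieb (low j i) (x j)]>)%VS.
have U3 y : lcs F 3 y -> y \in U.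
  by move=> h; apply: (subvP (addvSl _ _)); apply/(vspan_subspaceP _ (lcs_subspace F 3)).
have Ulow (i j : 'I_n) : (i < j)%N -> lieb (x i) (x j) \in U.
  move=> ij; apply: (subvP (addvSr _ _)).
  apply: (subvP (sumv_sup j _ (subvv _))) => //.
  apply: (subvP (sumv_sup (Ordinal ij) _ (subvv _))) => //.
  by rewrite (_ : x i = low j (Ordinal ij)) ?memv_line //; congr x; apply: val_inj.
have UP y z : lieb y z \in U.
  move: y z; apply: (@fn_ind _ _ _ (fun y => forall z, lieb y z \in U)).
  - split=> [z|b y y' hy hy' z]; first by rewrite lieb0l mem0v.
    by rewrite liebDl liebZl memvD // memvZ.
  - move=> y y' _ _ z; rewrite lieb_anti memvN; apply: U3.
    by apply: (@lcs_lieb _ _ 2); apply: (@lcs_lieb _ _ 1).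
  move=> i; apply: fn_ind => [|z z' _ _|j].
  - by split=> [|b y y' hy hy']; rewrite /= ?lieb0r ?mem0v // liebDr liebZr memvD // memvZ.
  - by apply: U3; apply: (@lcs_lieb _ _ 2); apply: (@lcs_lieb _ _ 1).
  have [ij|ji|/val_inj->] := ltngtP i j; first exact: Ulow.
    by rewrite lieb_anti memvN; apply: Ulow.
  by rewrite liebxx mem0v.
apply: (@leq_trans (\dim U)).
  by apply/dimvS; apply: vspan_sub; rewrite lcsSS; apply: (@lspan_min _ _ _ (fun y => y \in U));
    [split=> [|a y z yU zU]; rewrite ?mem0v // memvD // memvZ|move=> _ [y [z [_ ->]]]].
apply: leq_trans (dimv_add_leqif _ _) _; rewrite leq_add2l.
apply: leq_trans (dimv_leq_sum _ _ _) _; rewrite -bin2_sum big_mkord.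
apply: leq_sum => j _; apply: leq_trans (dimv_leq_sum _ _ _) _.
rewrite -[leqRHS]card_ord -sum1_card; apply: leq_sum => i _.
by rewrite dim_vline; case: (_ != 0).
Qed.

(** The second cohomology of a free nilpotent algebra is dual to the next homogeneous
    component of the free Lie algebra. *)
Lemma b2_freeNil i : (0 < i < r)%N ->
  (b2 (freeNil K n i) + sdim (lcs F i.+2) = sdim (lcs F i.+1))%N.
Proof.
move=> /andP[i0 ir]; have [f [fM fg fS fker]] := @fn_proj K n i.+1 i (leqnSn i).
have kerE : ext_ker f = lcs (freeNil K n i.+1) i.+1.
  by apply/seteqP; split=> y; apply fker.
have := @hopf_formula K (freeNil K n i) n i.+1 f fM fS (ltn0Sn i).
rewrite kerE => /(_ (lcs_decr (i0 : (2 <= i.+1)%N)) (@freeNil_lcs_eq0 K n i)).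
have -> : brs (lcs (freeNil K n i.+1) i.+1) = lcs (freeNil K n i.+1) i.+2 by [].
rewrite (sdim_eq0 (@freeNil_lcs_eq0 K n i.+1)) addn0 => ->.
have [q [qM qg qS qker]] := @fn_proj K n r i.+1 ir.
rewrite (sdim_rank qM.1 (lcs_subspace F i.+1)); congr (_ + _)%N; congr sdim.
  apply/seteqP; split=> [y hy|_ [y hy <-]]; last exact: lcs_morph.
  by have [z hz <-] := lcs_morph_onto qM qS hy; exists z.
apply/seteqP; split=> y => [hy|[_ /qker]//].
by split; [apply: lcs_decrS|apply/qker].
Qed.

End FreeNilpotentDimensions.

Section Cover.
Variables (K : fieldType) (g : lieVectType K) (n p d : nat) (f : freeNil K n p -> g).
Hypotheses (fM : lie_morphism f) (fS : forall y, exists x, f x = y).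
Local Notation F := (freeNil K n p).
Local Notation F1 := (freeNil K n p.+1).

(** If the kernel [N] of [f] is generated by [S] in degree [d], then [N] is the span of
    [S] plus [[F, N]], and the span of [S] meets [lcs F d.+1] only in zero. *)
Lemma generated_low : (d <= p)%N -> (ext_ker f `<=` lcs F d)%classic ->
  generated_in_degree f d ->
  (ext_ker f `&` lcs F d.+1 `<=` brs (ext_ker f))%classic.
Proof.
move=> dp Nd [S Shom NS] y [Ny yd].
have SN : (S `<=` ext_ker f)%classic by move=> z Sz; rewrite NS => I _; apply.
have Nid : lie_ideal (ext_ker f) := ker_ideal fM.
have bid := brs_ideal_sub Nid.
pose I y := exists2 s, lspan S s & exists2 w, brs (ext_ker f) w & y = s + w.
have [s hs [w hw yE]] : I y.
  have : ideal_gen S y by rewrite -NS.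
  apply; last first.
    move=> s Ss; exists s; first exact: lspan_sub.
    by exists 0; [exact: (brs_subspace _).1|rewrite addr0].
  split.
    split.
      exists 0; first exact: (lspan_subspace _).1.
      by exists 0; [exact: (brs_subspace _).1|rewrite addr0].
    move=> a _ _ [s hs [w hw ->]] [s' hs' [w' hw' ->]].
    exists (a *: s + s'); first exact: (lspan_subspace _).2.
    exists (a *: w + w'); first exact: (brs_subspace _).2.
    by rewrite scalerDr addrACA.
  move=> z _ [s hs [w hw ->]]; exists 0; first exact: (lspan_subspace _).1.
  exists (lieb z (s + w)); last by rewrite add0r.
  apply: brs_lieb; apply: (subspaceD Nid.1); last exact: bid.
  exact: (lspan_min Nid.1 SN).
suff s0 : s = 0 by rewrite yE s0 add0r.
apply: (@fn_homog_lcs K n p d) => //.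
  by move: s hs {yE}; apply: lspan_min => //; exact: lspan_subspace.
have -> : s = y - w by rewrite yE addrK.
apply: (subspaceB (lcs_subspace F d.+1)) => //.
move: w hw {yE}; apply: lspan_min; first exact: lcs_subspace.
by move=> _ [z [t [/Nd ht ->]]]; apply: lcs_lieb.
Qed.

(** Hopf's formula for an algebra of class [p] is used with the free nilpotent algebra
    of class [p + 1], where the brackets of [lcs F1 p.+1] vanish but those of degree
    [p] survive. *)
Lemma cover : (0 < d <= p)%N -> (ext_ker f `<=` lcs F d)%classic ->
  exists f1 : F1 -> g, [/\ lie_morphism f1, forall y, exists x, f1 x = y,
    (ext_ker f1 `<=` lcs F1 d)%classic, (lcs F1 p.+1 `<=` ext_ker f1)%classic &
    (ext_ker f `&` lcs F d.+1 `<=` brs (ext_ker f))%classic ->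
    forall x, (ext_ker f1 `&` lcs F1 d.+1)%classic x ->
    exists y z, [/\ brs (ext_ker f1) y, lcs F1 p.+1 z & x = y + z]].
Proof.
move=> /andP[d0 dp] Nd; have [q [qM qg qS qker]] := @fn_proj K n p.+1 p (leqnSn p).
have f1M : lie_morphism (f \o q).
  by split=> [a x y|x y] /=; rewrite ?qM.1 ?qM.2 ?fM.1 ?fM.2.
exists (f \o q); split=> // [y|x /= /Nd|x /qker /= x0|bN x [Rx xd]].
- by have [x <-] := fS y; have [z <-] := qS x; exists z.
- move=> /(lcs_morph_onto qM qS)[z hz zx].
  rewrite -[x](subrK z); apply: (subspaceD (lcs_subspace _ _)) => //.
  apply: (lcs_decr (leqW dp)); apply/qker.
  by rewrite (lmorphB qM) zx subrr.
- by rewrite /ext_ker /= x0 (lmorph0 fM).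
have [y hy yx] : exists2 y, brs (ext_ker (f \o q)) y & q y = q x.
  have := bN (q x) (conj Rx (lcs_morph qM xd)); move: (q x).
  apply: (@lspan_min _ _ _ (fun z => exists2 y, brs (ext_ker (f \o q)) y & q y = z)).
    split; first by exists 0; [exact: (brs_subspace _).1|exact: lmorph0].
    move=> a _ _ [u hu <-] [v hv <-]; exists (a *: u + v); last by rewrite qM.1.
    exact: (brs_subspace _).2.
  move=> _ [u [v [Nv ->]]]; have [u' <-] := qS u; have [v' vE] := qS v.
  exists (lieb u' v'); last by rewrite qM.2 vE.
  by apply: brs_lieb; rewrite /ext_ker /= vE.
exists y, (x - y); split=> //; last by rewrite addrC subrK.
by apply/qker; rewrite (lmorphB qM) yx subrr.
Qed.

End Cover.

(** * The bounds on the second Betti number *)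

Section Bounds.
Variables (K : fieldType) (g : lieVectType K) (n p d : nat).
Variable f : freeNil K n p.+1 -> g.
Hypotheses (fM : lie_morphism f) (fS : forall y, exists x, f x = y).
Hypothesis dp : (1 < d <= p)%N.
Local Notation F := (freeNil K n p.+1).
Local Notation R := (ext_ker f).
Hypotheses (Rd : (R `<=` lcs F d)%classic) (pR : (lcs F p.+1 `<=` R)%classic).

Let Rid : lie_ideal R := ker_ideal fM.

Lemma lcs_cover_eq0 x : lcs g p.+1 x -> x = 0.
Proof. by move=> /(lcs_morph_onto fM fS)[y /pR <-]. Qed.

Lemma sdim_lcs_quot i : (sdim (lcs g i) + sdim (lcs F i `&` R)%classic = sdim (lcs F i))%N.
Proof.
rewrite (sdim_rank fM.1 (lcs_subspace F i)); congr (_ + _)%N; congr sdim.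
apply/seteqP; split=> [y hy|_ [x hx <-]]; last exact: lcs_morph.
by have [x hx <-] := lcs_morph_onto fM fS hy; exists x.
Qed.

Lemma quodim_lcs i :
  (quodim (lcs g i) (lcs g i.+1) + sdim (lcs g i.+1) = sdim (lcs g i))%N.
Proof. by rewrite /quodim subnK //; apply: sdim_le; apply: lcs_decrS. Qed.

Lemma hopf_cover : (b2 g + sdim (brs R) = sdim R)%N.
Proof.
apply: (hopf_formula fM fS) => //; last exact: lcs_cover_eq0.
by move=> x /Rd; apply: lcs_decr; case/andP: dp.
Qed.

Lemma sdim_lcsIR i : (i <= d)%N -> sdim (lcs F i `&` R)%classic = sdim R.
Proof.
move=> id; congr sdim; apply/seteqP; split=> [x []//|x Rx]; split=> //.
exact: (lcs_decr id (Rd Rx)).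
Qed.

Lemma sdim_brs_low : (sdim (brs R) <= sdim (lcs F d.+1 `&` R)%classic)%N.
Proof.
apply: sdim_le; apply: lspan_min.
  exact: subspaceI (lcs_subspace F d.+1) Rid.1.
by move=> _ [x [y [Ry ->]]]; split; [apply/lcs_lieb/Rd|apply: Rid.2].
Qed.

(** The brackets with a generator embed [R_p / lcs p.+1] into [lcs p.+1], where
    [R_p] is the part of [R] in [lcs F p]. *)
Lemma sdim_brs_ge (i : 'I_n) :
  (sdim (lcs F p `&` R)%classic <=
   sdim (brs R `&` lcs F p.+1)%classic + sdim (lcs F p.+1))%N.
Proof.
have [d1 dpp] := andP dp.
rewrite (sdim_rank (lieb_linearr (@fn_gen K n p.+1 i)) (subspaceI (lcs_subspace F p) Rid.1)).
apply: leq_add; apply: sdim_le.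
  move=> _ [x [hx Rx] <-]; split; [exact: brs_lieb|exact: lcs_lieb].
move=> x [[hx _] x0]; move: hx x0; apply: ad_gen_inj.
exact: leq_trans dpp.
Qed.

Lemma sdim_generated :
  (forall x, (R `&` lcs F d.+1)%classic x ->
    exists y z, [/\ brs R y, lcs F p.+1 z & x = y + z]) ->
  (sdim (lcs F d.+1 `&` R)%classic + sdim (brs R `&` lcs F p.+1)%classic <=
   sdim (brs R) + sdim (lcs F p.+1))%N.
Proof.
move=> H; apply: (sdim_sumle (brs_subspace R) (lcs_subspace F p.+1)).
by move=> x [xd Rx]; apply: H.
Qed.

(** Comparison of [R] with the ideal [lcs F p.+1], whose brackets vanish. The bound is
    of use in depth [p], where [[F, R]] lives in a single degree. *)
Lemma sdim_brs_depth_top : (sdim (brs R) <= n * (sdim R - sdim (lcs F p.+1)))%N.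
Proof.
apply: leq_trans (sdim_brs Rid (lcs_ideal F p.+1) pR) _.
by rewrite [sdim (brs _)]sdim_eq0 //; apply: (@freeNil_lcs_eq0 K n p.+1).
Qed.

(** Comparison of [R] with the derived algebra, whose own quotient by its brackets has
    dimension at most that of the exterior square. Since [sdim (lcs g 2)] is
    [m - n 1] in the notation of the main statement, this is the bound [C]. *)
Lemma b2_upper : (b2 g + sdim (lcs g 2) <= 'C(n, 2) + n * sdim (lcs g 2))%N.
Proof.
have R2 : (R `<=` lcs F 2)%classic.
  by move=> x /Rd; apply: lcs_decr; case/andP: dp.
have := sdim_brs (lcs_ideal F 2) Rid R2.
rewrite [brs (lcs F 2)](_ : _ = lcs F 3) //.
have := sdim_lcs_quot 2; rewrite sdim_lcsIR; last by case/andP: dp.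
have := sdim_lcs2 K n p.+1; have := hopf_cover => h1 h2 h3.
have -> : (sdim (lcs F 2) - sdim R = sdim (lcs g 2))%N by lia.
lia.
Qed.

End Bounds.

Theorem corollary1p9 (K : fieldType) (g : lieVectType K) (p m d : nat)
    (n : nat -> nat) (pi : freeNil K (n 1%N) p -> g) :
  step_nilpotent g p -> has_type g p n -> \dim {:g} = m ->
  free_nilpotent_ext pi -> has_depth pi d ->
  let b (r : nat) : int := (b2 (freeNil K (n 1%N) r))%:Z in
  let b2g : int := (b2 g)%:Z in
  let N (i : nat) : int := (n i)%:Z in
  let c : int := b (d - 1)%N - N d in
  let C : int := 'C(n 1%N, 2)%:Z + (m%:Z - N 1%N) * (N 1%N - 1) in
  [/\ c <= b2g <= C,
      generated_in_degree pi d ->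
        c <= b2g <= Num.min (c + b p - b (p - 1)%N + N p) C &
      d = p ->
        c + Num.max 0 (b p - N 1%N * b (p - 1)%N + N 1%N * N p) <= b2g
          <= Num.min (c + b p - b (p - 1)%N + N p) C].
Proof.
move=> [p0 _ g0] ty mE [piM piS ker2] [[x0 Nx0 x00] Nd dmax] b b2g N c C.
have d2 : (2 <= d)%N by apply: dmax.
have dp : (d <= p)%N.
  rewrite leqNgt; apply/negP => pd; case/negP: x00; apply/eqP.
  exact/freeNil_lcs_eq0/(lcs_decr pd)/Nd.
have [f [fM fS Rd pR gen]] :=
  cover piM piS (introT andP (conj (ltnW d2) dp) : (0 < d <= p)%N) Nd.
have dp2 : (1 < d <= p)%N by rewrite d2.
have [i _] : exists i : 'I_(n 1%N), true.
  move: x00; case: (n 1%N) pi piM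
    {piS ker2 Nx0 Nd dmax f fM fS Rd pR gen b N c C} x0 => [|k] _ _ x0.
    case/negP; apply/eqP; move: x0; apply: fn_ind => [|x y -> _|[]//].
      by split=> // a x y /= -> ->; rewrite scaler0 addr0.
    by rewrite /= lieb0l.
  by exists ord0.
set F := freeNil K (n 1%N) p.+1 in f fM fS Rd pR gen.
pose D j := sdim (lcs F j); pose G j := sdim (lcs g j).
set R := ext_ker f in Rd pR gen.
pose Y := sdim (lcs F d.+1 `&` R)%classic; pose T := sdim (lcs F p `&` R)%classic.
have hopf : (b2 g + sdim (brs R) = sdim R)%N := hopf_cover fM fS dp2 Rd pR.
have Gp : G p.+1 = 0%N by apply: sdim_eq0.
have Dp : D p.+2 = 0%N by apply/sdim_eq0/freeNil_lcs_eq0.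
have bE j : (0 < j <= p)%N -> (b2 (freeNil K (n 1%N) j) + D j.+2 = D j.+1)%N.
  by move=> jp; apply: (@b2_freeNil K (n 1%N) p.+1 j).
have nE j : (0 < j <= p)%N -> (n j + G j.+1 = G j)%N.
  by move=> jp; rewrite (ty _ jp); apply: quodim_lcs.
have GE j : (G j + sdim (lcs F j `&` R)%classic = D j)%N by apply: sdim_lcs_quot.
have G2 : (G 2 + sdim R = D 2)%N by rewrite -(GE 2) (sdim_lcsIR Rd).
have GR : (G d + sdim R = D d)%N by rewrite -(GE d) (sdim_lcsIR Rd).
have G1 : G 1%N = m by rewrite -mE -sdimT.
have n1 := nE 1%N (introT andP (conj isT p0)).
have nd : (n d + G d.+1 = G d)%N by apply: nE; lia.
have np : (n p + G p.+1 = G p)%N by apply: nE; lia.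
have bd : (b2 (freeNil K (n 1%N) (d - 1)) + D d.+1 = D d)%N.
  have := bE (d - 1)%N; have -> : (d - 1).+1 = d by lia.
  by apply; lia.
have bp : (b2 (freeNil K (n 1%N) p) + D p.+2 = D p.+1)%N by apply: bE; lia.
have bp1 : (b2 (freeNil K (n 1%N) (p - 1)) + D p.+1 = D p)%N.
  have := bE (p - 1)%N; have -> : (p - 1).+1 = p by lia.
  by apply; lia.
have GY : (G d.+1 + Y = D d.+1)%N := GE d.+1.
have GT : (G p + T = D p)%N := GE p.
have cE : c = (sdim R)%:Z - Y%:Z by rewrite /c /b /N; lia.
have low : c <= b2g.
  have := sdim_brs_low fM Rd; rewrite -/R -/Y => YB.
  by rewrite cE /b2g; lia.
have upC : b2g <= C.
  have := b2_upper fM fS dp2 Rd pR; rewrite -/(G 2) => h.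
  have CE : C = ('C(n 1%N, 2) + n 1%N * G 2)%N%:Z - (G 2)%:Z.
    by rewrite /C /N -G1 -n1 !PoszD PoszM; ring.
  by rewrite CE /b2g lerBrDr -PoszD lez_nat.
have up : (forall x, (R `&` lcs F d.+1)%classic x ->
      exists y z, [/\ brs R y, lcs F p.+1 z & x = y + z]) ->
    b2g <= Num.min (c + b p - b (p - 1)%N + N p) C.
  move=> H; rewrite le_min upC andbT.
  have := sdim_generated H; have := sdim_brs_ge fM dp2 i.
  rewrite -/R -/T -/Y -/(D p.+1) cE /b2g /b /N; lia.
split; first by rewrite low upC.
  by move=> /(generated_low piM dp Nd) h; rewrite low up //; apply: gen.
move=> dpE; apply/andP; split; last first.
  apply: up => x [_]; rewrite {1}dpE => xp; exists 0, x; rewrite add0r; split=> //.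
  exact: (brs_subspace _).1.
have YD : Y = D p.+1.
  rewrite /Y dpE; congr sdim; apply/seteqP; split=> [x []//|x xp]; split=> //; exact: pR.
have TR : T = sdim R by apply: (sdim_lcsIR Rd); rewrite dpE.
case: (leP 0) => _; last by rewrite addr0.
have := sdim_brs_depth_top fM pR; rewrite -/R -/(D p.+1) => h.
have DR : (D p.+1 <= sdim R)%N by apply: sdim_le.
have e : (n 1%N)%:Z * b (p - 1)%N - (n 1%N)%:Z * N p =
    (n 1%N * (sdim R - D p.+1))%N%:Z.
  by rewrite -mulrBr PoszM; congr (_ * _); rewrite /b /N; lia.
have : c + (b p - N 1%N * b (p - 1)%N + N 1%N * N p) =
    c + b p - (n 1%N * (sdim R - D p.+1))%N%:Z by rewrite -e /N; ring.
by move=> ->; rewrite cE /b /b2g; lia.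
Qed.
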